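(* Let $\mathcal B\colon \mathsf{uS\ell g}^{\mathrm{op}}\to\mathsf{Bms}$ be defined on objects by $\mathcal B(S,u)=(\operatorname{MaxSpec}(S),u^\natural)$ and on a unital $\ell$-homomorphism $\psi\colon(S,u)\to(T,v)$ by $\mathcal B_\psi\colon \operatorname{MaxSpec}(T)\to\operatorname{MaxSpec}(S)$, $\mathfrak m\mapsto\psi^{-1}(\mathfrak m)=\{f\in S\mid \psi(f)\in\mathfrak m\}$. Then $\mathcal B$ is a well-defined functor, and $\mathcal S$ and $\mathcal B$ are part of an adjoint dual equivalence between $\mathsf{Bms}$ and $\mathsf{uS\ell g}$ whose unit is the family of maps $\mathfrak M_X\colon (X,u)\to(\operatorname{MaxSpec}(C_X),u^\natural)$, $x\mapsto\{f\in C_X\mid f(x)=0\}$, for $(X,u)\in\mathsf{Bms}$, and whose counit is the family of maps $g\mapsto g^\natural$ from $(S,u)$ to $(C_{\operatorname{MaxSpec}(S)},u^\natural)$, for $(S,u)\in\mathsf{uS\ell g}$.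
   Context: An $\ell$-group is a lattice-ordered abelian group. A unit of an $\ell$-group $G$ is $u\ge0$ such that every $g$ satisfies $|g|\le nu$ for some $n\in\mathbb Z_{>0}$; $(G,u)$ is a unital $\ell$-group; unital $\ell$-homomorphisms are $\ell$-homomorphisms preserving the unit. A singular element is $s\ge0$ with $a\wedge(s-a)=0$ for all $0\le a\le s$; a Specker $\ell$-group is generated as a group by its singular elements; $\mathsf{uS\ell g}$ is the category of unital Specker $\ell$-groups and unital $\ell$-homomorphisms. An ideal is a proper convex $\ell$-subgroup; $\operatorname{MaxSpec}(S)$ is the set of maximal ideals with the topology having as basis of closed sets the sets $\{\mathfrak m\mid g\in\mathfrak m\}$, $g\in S$. For a unital Specker $\ell$-group $(S,u)$ and $\mathfrak m\in\operatorname{MaxSpec}(S)$ there is a unique surjective $\ell$-homomorphism $\rho_{\mathfrak m}\colon S\to\mathbb Z$ with kernel $\mathfrak m$; for $g\in S$, $g^\natural\colon\operatorname{MaxSpec}(S)\to\mathbb Z$ is $\mathfrak m\mapsto\rho_{\mathfrak m}(g)$. A boolean space is a totally disconnected compact Hausdorff space. A boolean multispace is $(X,u)$ with $X$ boolean and $u\colon X\to\mathbb Z_{>0}$ continuous; $\mathsf{Bms}$-morphisms $(X,u_X)\to(Y,u_Y)$ are continuous $\gamma$ with $u_Y(\gamma(x))\mid u_X(x)$ for all $x$. $C_X$ is the $\ell$-group of continuous maps $X\to\mathbb Z$ ($\mathbb Z$ discrete). $\mathcal S\colon\mathsf{Bms}\to\mathsf{uS\ell g}^{\mathrm{op}}$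 sends $(X,u)$ to $(C_X,u)$ and $\gamma\colon(W,u_W)\to(V,u_V)$ to $\mathcal S_\gamma(f)(w)=f(\gamma(w))\,u_W(w)/u_V(\gamma(w))$. An adjoint dual equivalence is an adjunction between $\mathsf{Bms}$ and $\mathsf{uS\ell g}^{\mathrm{op}}$ whose unit and counit are natural isomorphisms. *)

(* Defs.v *)
From HB Require Import structures.
From mathcomp Require Import all_boot all_order all_algebra.
From mathcomp Require Import finmap boolp classical_sets functions topology.
From mathcomp Require Import zify.

Set Implicit Arguments.
Unset Strict Implicit.
Unset Printing Implicit Defensive.

Import Order.TTheory GRing.Theory Num.Theory.
Local Open Scope classical_set_scope.
Local Open Scope ring_scope.

(** * Categories *)

Record category := Category {
  obj : Type;
  hom : obj -> obj -> Type;
  idm : forall a, hom a a;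
  compose : forall a b c, hom b c -> hom a b -> hom a c;
  compose1m : forall a b (f : hom a b), compose (idm b) f = f;
  composem1 : forall a b (f : hom a b), compose f (idm a) = f;
  composeA : forall a b c d (h : hom c d) (g : hom b c) (f : hom a b),
    compose h (compose g f) = compose (compose h g) f }.

Arguments idm {_} _.
Arguments compose {_ _ _ _} _ _.

Definition op (C : category) : category :=
  @Category (obj C) (fun a b => hom b a) (fun a => idm a)
    (fun a b c g f => compose f g)
    (fun a b f => composem1 f) (fun a b f => compose1m f)
    (fun a b c d h g f => esym (composeA f g h)).

(* [functor_on F0] is the type of functors with object part F0. *)
Record functor_on (C D : category) (F0 : obj C -> obj D) := FunctorOn {
  functor_map : forall a b, hom a b -> hom (F0 a) (F0 b);
  functor_id : forall a, functor_map (idm a) = idm (F0 a);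
  functor_compose : forall a b c (g : hom b c) (f : hom a b),
    functor_map (compose g f) = compose (functor_map g) (functor_map f) }.

Arguments functor_map {_ _ _} _ {_ _} _.

Definition is_iso (C : category) (a b : obj C) (f : hom a b) : Prop :=
  exists g : hom b a, compose g f = idm a /\ compose f g = idm b.

(* F is left adjoint to G with unit eta and counit eps (naturality and the
   triangle identities), and all components of eta and eps are isomorphisms. *)
Record adjoint_equivalence (C D : category)
    (F0 : obj C -> obj D) (G0 : obj D -> obj C)
    (F : functor_on F0) (G : functor_on G0)
    (eta : forall a : obj C, hom a (G0 (F0 a)))
    (eps : forall b : obj D, hom (F0 (G0 b)) b) : Prop := {
  unit_natural : forall (a a' : obj C) (f : hom a a'),
    compose (eta a') f = compose (functor_map G (functor_map F f)) (eta a);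
  counit_natural : forall (b b' : obj D) (g : hom b b'),
    compose (eps b') (functor_map F (functor_map G g)) = compose g (eps b);
  triangle_left : forall a : obj C,
    compose (eps (F0 a)) (functor_map F (eta a)) = idm (F0 a);
  triangle_right : forall b : obj D,
    compose (functor_map G (eps b)) (eta (G0 b)) = idm (G0 b);
  unit_iso : forall a : obj C, is_iso (eta a);
  counit_iso : forall b : obj D, is_iso (eps b) }.

(** * Lattice-ordered abelian groups *)

(* Meet and join are fields here rather than inherited from [latticeType]
   because joining [latticeType] and [zmodType] would clash with
   [realDomainType] in the Hierarchy-Builder hierarchy.  The two instances
   below make the library's meet, join and lattice theory available on every
   [lgroupType]. *)
HB.mixin Record isLatticeOrderedGroup G of Num.POrderedZmodule G := {
  lg_meet : G -> G -> G;
  lg_join : G -> G -> G;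
  lg_lexI : forall x y z : G, (x <= lg_meet y z) = (x <= y) && (x <= z);
  lg_leUx : forall x y z : G, (lg_join x y <= z) = (x <= z) && (y <= z);
  lg_leD2l : forall z x y : G, x <= y -> z + x <= z + y }.

#[short(type="lgroupType")]
HB.structure Definition LGroup :=
  { G of Num.POrderedZmodule G & isLatticeOrderedGroup G }.

#[non_forgetful_inheritance]
HB.instance Definition _ (G : lgroupType) :=
  Order.POrder_isMeetSemilattice.Build ring_display (LGroup.sort G)
    (@lg_lexI G).
#[non_forgetful_inheritance]
HB.instance Definition _ (G : lgroupType) :=
  Order.POrder_isJoinSemilattice.Build ring_display (LGroup.sort G)
    (@lg_leUx G).

Fact int_leD2l (z x y : int) : x <= y -> z + x <= z + y.
Proof. by rewrite lerD2l. Qed.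
HB.instance Definition _ :=
  isLatticeOrderedGroup.Build int (@lexI _ int) (@leUx _ int) int_leD2l.

Section LGroupDefs.
Context {G : lgroupType}.
Implicit Types (u s a g x y : G) (I H : set G).

Definition labs g : G := (g `|` - g)%O.

Definition is_unit u : Prop :=
  0 <= u /\ forall g, exists2 n : nat, (0 < n)%N & labs g <= u *+ n.

Definition singular s : Prop :=
  0 <= s /\ forall a, 0 <= a -> a <= s -> (a `&` (s - a))%O = 0.

Definition subgroup H : Prop :=
  H 0 /\ forall x y, H x -> H y -> H (x - y).

Definition ideal I : Prop :=
  [/\ subgroup I,
      (forall x y, I x -> I y -> I (x `&` y)%O /\ I (x `|` y)%O),
      (forall a x y, I x -> I y -> x <= a -> a <= y -> I a)
    & I != setT].

Definition maximal_ideal I : Prop :=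
  ideal I /\ forall J : set G, ideal J -> I `<=` J -> J = I.

End LGroupDefs.

Definition specker (G : lgroupType) : Prop :=
  smallest (@subgroup G) (@singular G) = setT.

Definition is_lhom (G H : lgroupType) (f : G -> H) : Prop :=
  [/\ zmod_morphism f,
      {morph f : x y / (x `&` y)%O >-> (x `&` y)%O}
    & {morph f : x y / (x `|` y)%O >-> (x `|` y)%O}].

(** ** Auxiliary facts on lattice-ordered groups *)

Section LGroupTheory.
Context {G : lgroupType}.
Implicit Types (x y z a b : G) (I : set G).

Lemma lgD2l z x y : (z + x <= z + y) = (x <= y).
Proof.
apply/idP/idP => [h|]; last exact: lg_leD2l.
by have := lg_leD2l (- z) _ _ h; rewrite !addKr.
Qed.

Lemma lgD2r z x y : (x + z <= y + z) = (x <= y).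
Proof. by rewrite ![_ + z]addrC lgD2l. Qed.

Lemma lgD x y z t : x <= y -> z <= t -> x + z <= y + t.
Proof. by move=> xy zt; apply: (@le_trans _ _ (y + z)); rewrite ?lgD2r ?lgD2l. Qed.

Lemma lgN2 x y : (- x <= - y) = (y <= x).
Proof. by rewrite -[LHS](lgD2l (x + y)) addrK [x + y]addrC addrK. Qed.

Lemma lgD_ge0 x y : 0 <= x -> 0 <= y -> 0 <= x + y.
Proof. by move=> x0 y0; rewrite -[0]addr0; exact: lgD. Qed.

Lemma lgMn_ge0 x n : 0 <= x -> 0 <= x *+ n.
Proof. by move=> x0; elim: n => // n ih; rewrite mulrS; exact: lgD_ge0. Qed.

Lemma lgDIr z x y : (x `&` y)%O + z = ((x + z) `&` (y + z))%O.
Proof.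
apply/eqP; rewrite eq_le lexI !lgD2r leIl leIr /=.
by rewrite -(lgD2r (- z)) addrK lexI -(lgD2r z) subrK leIl -(lgD2r z) subrK leIr.
Qed.

Lemma lg_meetDle x y z : 0 <= x -> 0 <= y -> 0 <= z ->
  ((x `&` (y + z)) <= (x `&` y) + (x `&` z))%O.
Proof.
move=> x0 y0 z0; rewrite lgDIr ![_ + (x `&` z)%O]addrC !lgDIr !lexI -!andbA.
apply/and4P; split.
- by apply: (le_trans (leIl _ _)); rewrite -[X in X <= _]addr0 lgD2l.
- by apply: (le_trans (leIl _ _)); rewrite -[X in X <= _]add0r lgD2r.
- by apply: (le_trans (leIl _ _)); rewrite -[X in X <= _]addr0 lgD2l.
- by apply: (le_trans (leIr _ _)); rewrite addrC.
Qed.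

Lemma lg_meetMn x y n : 0 <= x -> 0 <= y ->
  ((x `&` (y *+ n)) <= (x `&` y) *+ n)%O.
Proof.
move=> x0 y0; elim: n => [|n ih]; first by rewrite !mulr0n leIr.
rewrite !mulrS; apply: (le_trans (lg_meetDle x0 y0 (lgMn_ge0 n y0))).
by rewrite lgD2l.
Qed.

Lemma lg_abs_ge x : x <= labs x. Proof. exact: leUl. Qed.
Lemma lg_abs_geN x : - x <= labs x. Proof. exact: leUr. Qed.

Lemma lg_abs_ge0 x : 0 <= labs x.
Proof.
have : 0 <= labs x + labs x.
  by rewrite -(subrr x); apply: lgD; rewrite ?lg_abs_ge ?lg_abs_geN.
move: (labs x) => a aa0.
have : (a `&` 0)%O + (a `&` 0)%O = (a `&` 0)%O.
  rewrite {1}lgDIr add0r [a + _]addrC lgDIr add0r; apply: meet_r.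
  by rewrite lexI leIl andbT (le_trans (leIr _ _)).
by move=> /(canRL (addrK _)); rewrite subrr => <-; exact: leIl.
Qed.

Lemma ideal0 I : ideal I -> I 0. Proof. by case=> -[]. Qed.

Lemma idealB I x y : ideal I -> I x -> I y -> I (x - y).
Proof. by case=> -[_ h] _ _ _; exact: h. Qed.

Lemma idealN I x : ideal I -> I x -> I (- x).
Proof. by move=> iI Ix; rewrite -sub0r; apply: idealB => //; exact: ideal0. Qed.

Lemma idealD I x y : ideal I -> I x -> I y -> I (x + y).
Proof. by move=> iI Ix Iy; rewrite -[y]opprK; apply: idealB => //; exact: idealN. Qed.

Lemma idealMn I x n : ideal I -> I x -> I (x *+ n).
Proof.
move=> iI Ix; elim: n => [|n ih]; first exact: ideal0.
by rewrite mulrS; exact: idealD.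
Qed.

Lemma ideal_abs I x : ideal I -> I x -> I (labs x).
Proof. by move=> iI Ix; case: (iI) => _ h _ _; case: (h x (- x)) => //; exact: idealN. Qed.

Lemma ideal_le I x y : ideal I -> I y -> 0 <= x -> x <= y -> I x.
Proof. by move=> iI Iy x0 xy; case: (iI) => _ _ h _; apply: (h x 0 y) => //; exact: ideal0. Qed.

Lemma ideal_absE I x : ideal I -> I (labs x) -> I x.
Proof.
move=> iI Iax; case: (iI) => _ _ h _; apply: (h x (- labs x) (labs x)) => //.
- exact: idealN.
- by rewrite -lgN2 opprK lg_abs_geN.
- exact: lg_abs_ge.
Qed.

Lemma maximal_prime I a b : maximal_ideal I -> 0 <= a -> 0 <= b ->
  I (a `&` b)%O -> I a \/ I b.
Proof.
move=> [iI maxI] a0 b0 Iab; have [Ia|nIa] := pselect (I a); [by left|right].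
pose J := [set y | exists p n,
  [/\ I p, 0 <= p, y <= p + a *+ n & - y <= p + a *+ n]].
have Jle y z : J y -> 0 <= z -> z <= y -> exists p n, [/\ I p, 0 <= p & z <= p + a *+ n].
  by move=> [p [n [? ? ? ?]]] _ zy; exists p, n; split=> //; exact: le_trans zy _.
have Jbd x y z : J x -> J y ->
    (forall p n q m, I p -> I q -> 0 <= p -> 0 <= q -> x <= p + a *+ n ->
      - x <= p + a *+ n -> y <= q + a *+ m -> - y <= q + a *+ m ->
      z <= (p + a *+ n) + (q + a *+ m) /\ - z <= (p + a *+ n) + (q + a *+ m)) ->
    J z.
  move=> [p [n [? ? ? ?]]] [q [m [? ? ? ?]]] h; exists (p + q), (n + m)%N.
  have [] := h p n q m => //; rewrite addrACA -mulrnDr => ? ?.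
  by split=> //; [exact: idealD|exact: lgD_ge0].
have pos p n : 0 <= p -> 0 <= p + a *+ n by move=> ?; apply: lgD_ge0; rewrite ?lgMn_ge0.
have ler x y z : 0 <= z -> x <= y -> x <= y + z.
  by move=> z0 xy; rewrite -[x]addr0; exact: lgD.
have lel x y z : 0 <= z -> x <= y -> x <= z + y by rewrite addrC; exact: ler.
have IJ : I `<=` J.
  move=> y Iy; exists (labs y), 0%N; rewrite mulr0n addr0; split.
  - exact: ideal_abs.
  - exact: lg_abs_ge0.
  - exact: lg_abs_ge.
  - exact: lg_abs_geN.
have Ja : J a.
  exists 0, 1%N; rewrite add0r mulr1n; split=> //; first exact: ideal0.
  by apply: (@le_trans _ _ 0) => //; rewrite -[X in _ <= X]oppr0 lgN2.
have [JT|JnT] := eqVneq J setT.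
  have : J b by rewrite JT.
  case=> p [n [Ip p0 bp _]].
  apply: (@ideal_le _ _ (p + (a `&` b)%O *+ n)) => //.
    by apply: idealD => //; exact: idealMn.
  rewrite -{1}(meet_l bp).
  apply: (le_trans (lg_meetDle b0 p0 (lgMn_ge0 n a0))).
  apply: lgD; first exact: leIr.
  by rewrite [(a `&` b)%O]meetC; exact: lg_meetMn.
exfalso; apply: nIa; rewrite -(maxI J) //; split=> //.
- split; first exact: (IJ _ (ideal0 iI)).
  move=> x y Jx Jy; apply: (Jbd x y) => // p n q m *.
  by split; [|rewrite opprB addrC]; exact: lgD.
- move=> x y Jx Jy; split; apply: (Jbd x y) => // p n q m ? ? p0 q0 hx hx' hy hy'.
  + split; first by apply: ler; rewrite ?pos// (le_trans (leIl _ _)).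
    rewrite -lgN2 opprK lexI; apply/andP; split.
      by rewrite -lgN2 opprK ler ?pos.
    by rewrite -lgN2 opprK lel ?pos.
  + split; first by rewrite leUx; apply/andP; split; [apply: ler|apply: lel]; rewrite ?pos.
    by apply: ler; rewrite ?pos// (le_trans _ hx')// lgN2 leUl.
- move=> z x y Jx Jy xz zy; apply: (Jbd x y) => // p n q m ? ? p0 q0 hx hx' hy hy'.
  split; first by rewrite lel ?pos// (le_trans zy).
  by rewrite ler ?pos// (le_trans _ hx')// lgN2.
Qed.

End LGroupTheory.

(** * The maximal spectrum *)

Record maxSpec (G : lgroupType) := MaxSpec {
  max_ideal : set G;
  max_idealP : maximal_ideal max_ideal }.

HB.instance Definition _ (G : lgroupType) := gen_eqMixin (maxSpec G).
HB.instance Definition _ (G : lgroupType) := gen_choiceMixin (maxSpec G).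

Section MaxSpecTopology.
Context (G : lgroupType).

(* Complements of the basic closed sets [set m | g \in m]. *)
Definition maxSpec_base : set (set (maxSpec G)) :=
  [set [set m : maxSpec G | ~ max_ideal m g] | g in setT].

Lemma maxSpec_base_cover : \bigcup_(U in maxSpec_base) U = setT.
Proof.
rewrite -subTset => m _; have [[_ _ _ /eqP mT] _] := max_idealP m.
have [g mg] : exists g, ~ max_ideal m g.
  by apply: contrapT => /forallNP h; apply: mT; rewrite -subTset => g _; apply: contrapT; exact: h.
by exists [set m' : maxSpec G | ~ max_ideal m' g] => //; exists g.
Qed.

Lemma maxSpec_base_join (U V : set (maxSpec G)) m :
  maxSpec_base U -> maxSpec_base V -> U m -> V m ->
  exists W, [/\ maxSpec_base W, W m & W `<=` U `&` V].
Proof.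
move=> [g _ <-] [h _ <-] /= mg mh; pose k := (labs g `&` labs h)%O.
have k0 : 0 <= k by rewrite lexI !lg_abs_ge0.
exists [set m' : maxSpec G | ~ max_ideal m' k]; split; first by exists k.
  move=> /= mk; have iM := (max_idealP m).1.
  have [] := maximal_prime (max_idealP m) (lg_abs_ge0 g) (lg_abs_ge0 h) mk.
    by move/(ideal_absE iM).
  by move/(ideal_absE iM).
move=> m' /= mk; have iM := (max_idealP m').1; split=> /= /(ideal_abs iM) hm; apply: mk.
  by apply: (ideal_le iM hm) => //; exact: leIl.
by apply: (ideal_le iM hm) => //; exact: leIr.
Qed.

HB.instance Definition _ := @isBaseTopological.Build (maxSpec G)
  (set (maxSpec G)) maxSpec_base id maxSpec_base_cover maxSpec_base_join.

End MaxSpecTopology.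

(* The surjective homomorphism onto int with kernel m, which exists and is
   unique when G is a unital Specker group; the null map is only a default
   value for the choice operator. *)
Definition rho (G : lgroupType) (m : maxSpec G) : G -> int :=
  xget (fun=> 0) [set r : G -> int |
    [/\ is_lhom r, range r = setT & r @^-1` [set 0] = max_ideal m]].

Definition natural_map (G : lgroupType) (g : G) : maxSpec G -> int :=
  fun m => rho m g.

(** * Unital Specker groups *)

Record uslg := Uslg {
  uslg_sort :> lgroupType;
  uslg_unit : uslg_sort;
  uslg_is_unit : is_unit uslg_unit;
  uslg_specker : specker uslg_sort }.

Record uslg_hom (S T : uslg) := UslgHom {
  uslg_fun :> S -> T;
  uslg_lhom : is_lhom uslg_fun;
  uslg_fun_unit : uslg_fun (uslg_unit S) = uslg_unit T }.

Lemma uslg_hom_eq (S T : uslg) (f g : uslg_hom S T) : f =1 g -> f = g.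
Proof.
case: f g => f f1 f2 [g g1 g2] /= /funext fg; case: _ / fg in g1 g2 *.
by congr UslgHom; exact: Prop_irrelevance.
Qed.

Lemma idfun_is_lhom (G : lgroupType) : is_lhom (@idfun G).
Proof. by []. Qed.

Lemma comp_is_lhom (G H K : lgroupType) (g : H -> K) (f : G -> H) :
  is_lhom g -> is_lhom f -> is_lhom (g \o f).
Proof.
by move=> [g1 g2 g3] [f1 f2 f3]; split=> x y /=; rewrite ?f1 ?f2 ?f3.
Qed.

Definition uslg_id (S : uslg) : uslg_hom S S :=
  @UslgHom S S idfun (idfun_is_lhom S) erefl.

Fact uslg_comp_unit (S T U : uslg) (g : uslg_hom T U) (f : uslg_hom S T) :
  (g \o f) (uslg_unit S) = uslg_unit U.
Proof. by rewrite /= !uslg_fun_unit. Qed.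

Definition uslg_comp (S T U : uslg) (g : uslg_hom T U) (f : uslg_hom S T) :
    uslg_hom S U :=
  UslgHom (comp_is_lhom (uslg_lhom g) (uslg_lhom f)) (uslg_comp_unit g f).

Definition uSlg : category.
Proof.
by refine (@Category uslg uslg_hom uslg_id uslg_comp _ _ _) => *;
  exact: uslg_hom_eq.
Defined.

(** * Boolean multispaces *)

Definition boolean_space (X : topologicalType) : Prop :=
  [/\ totally_disconnected [set: X], compact [set: X] & hausdorff_space X].

Definition continuousZ (X : topologicalType) (f : X -> int) : Prop :=
  continuous (f : X -> discrete_topology int).

Definition multispace_unit (X : topologicalType) (u : X -> int) : Prop :=
  continuousZ u /\ forall x, 0 < u x.

Record bms := Bmspace {
  bms_sort :> topologicalType;
  bms_unit : bms_sort -> int;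
  bms_boolean : boolean_space bms_sort;
  bms_unitP : multispace_unit bms_unit }.

Record bms_hom (X Y : bms) := BmsHom {
  bms_fun :> X -> Y;
  bms_cont : continuous bms_fun;
  bms_dvd : forall x, (bms_unit (bms_fun x) %| bms_unit x)%Z }.

Arguments bms_cont {X Y} b.

Lemma bms_hom_eq (X Y : bms) (f g : bms_hom X Y) : f =1 g -> f = g.
Proof.
case: f g => f f1 f2 [g g1 g2] /= /funext fg; case: _ / fg in g1 g2 *.
by congr BmsHom; exact: Prop_irrelevance.
Qed.

Fact bms_id_cont (X : bms) : continuous (@idfun X). Proof. by move=> x. Qed.

Fact bms_id_dvd (X : bms) (x : X) : (bms_unit (idfun x) %| bms_unit x)%Z.
Proof. exact: dvdzz. Qed.

Definition bms_id (X : bms) : bms_hom X X :=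
  BmsHom (@bms_id_cont X) (@bms_id_dvd X).

Fact bms_comp_cont (X Y Z : bms) (g : bms_hom Y Z) (f : bms_hom X Y) :
  continuous (g \o f).
Proof. by move=> x; apply: continuous_comp; exact: bms_cont. Qed.

Fact bms_comp_dvd (X Y Z : bms) (g : bms_hom Y Z) (f : bms_hom X Y) x :
  (bms_unit ((g \o f) x) %| bms_unit x)%Z.
Proof. exact: dvdz_trans (bms_dvd g _) (bms_dvd f _). Qed.

Definition bms_comp (X Y Z : bms) (g : bms_hom Y Z) (f : bms_hom X Y) :
  bms_hom X Z := BmsHom (@bms_comp_cont _ _ _ g f) (@bms_comp_dvd _ _ _ g f).

Definition Bms : category.
Proof.
by refine (@Category bms bms_hom bms_id bms_comp _ _ _) => *;
  exact: bms_hom_eq.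
Defined.

(** * The group of continuous integer-valued functions *)

Section ContZ.
Context {X : topologicalType}.

Lemma continuousZP (f : X -> int) :
  continuousZ f <-> forall x, nbhs x [set y | f y = f x].
Proof.
split=> [cf x|h x]; first exact: (cf x [set f x] (@discrete_set1 _ _)).
by apply/discrete_cvg; exact: h.
Qed.

Lemma continuousZ_op2 (op2 : int -> int -> int) (f g : X -> int) :
  continuousZ f -> continuousZ g -> continuousZ (fun x => op2 (f x) (g x)).
Proof.
move=> /continuousZP cf /continuousZP cg; apply/continuousZP => x.
by apply: filterS2 (cf x) (cg x) => y /= -> ->.
Qed.

Arguments continuousZ_op2 op2 {f g} _ _.

Lemma continuousZ_op1 (op1 : int -> int) (f : X -> int) :
  continuousZ f -> continuousZ (fun x => op1 (f x)).
Proof. by move=> cf; exact: (continuousZ_op2 (fun a _ => op1 a) cf cf). Qed.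

Lemma continuousZ_cst (c : int) : continuousZ (fun _ : X => c).
Proof. by apply/continuousZP => x; apply: filterE. Qed.

Definition contZ_pred : {pred X -> int} := fun f => `[< continuousZ f >].

Lemma contZ_zmod_closed : zmod_closed contZ_pred.
Proof.
split=> [|f g /asboolP cf /asboolP cg]; apply/asboolP.
  exact: continuousZ_cst.
exact: (continuousZ_op2 (fun a b => a - b)).
Qed.
HB.instance Definition _ :=
  GRing.isZmodClosed.Build (X -> int) contZ_pred contZ_zmod_closed.

End ContZ.

Arguments continuousZ_op2 {X} op2 {f g} _ _.
Arguments continuousZ_op1 {X} op1 {f} _.

Record contZ (X : topologicalType) := ContZ_sub {
  contZ_fun :> X -> int;
  contZ_subproof : contZ_fun \in @contZ_pred X }.

HB.instance Definition _ (X : topologicalType) :=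
  [isSub for @contZ_fun X].
HB.instance Definition _ (X : topologicalType) :=
  [Choice of contZ X by <:].
HB.instance Definition _ (X : topologicalType) :=
  [SubChoice_isSubZmodule of contZ X by <:].

Definition ContZ (X : topologicalType) (f : X -> int) (cf : continuousZ f) :
  contZ X := ContZ_sub (asboolT cf).

Section ContZLGroup.
Context {X : topologicalType}.
Implicit Types f g h : contZ X.

Lemma contZ_cont f : continuousZ f.
Proof. exact/asboolP/(contZ_subproof f). Qed.

Arguments contZ_cont f : clear implicits.

Lemma contZ_eq f g : f =1 g -> f = g.
Proof. by move=> fg; apply/val_inj/funext. Qed.

Definition contZ_le f g : bool := `[< forall x, f x <= g x >].

Fact contZ_le_refl : reflexive contZ_le.
Proof. by move=> f; apply/asboolP. Qed.

Fact contZ_le_anti : antisymmetric contZ_le.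
Proof.
move=> f g /andP[/asboolP fg /asboolP gf]; apply: contZ_eq => x.
by apply/eqP; rewrite eq_le fg gf.
Qed.

Fact contZ_le_trans : transitive contZ_le.
Proof.
move=> g f h /asboolP fg /asboolP gh; apply/asboolP => x.
exact: le_trans (fg x) (gh x).
Qed.

HB.instance Definition _ := Order.Le_isPOrder.Build ring_display (contZ X)
  contZ_le_refl contZ_le_anti contZ_le_trans.

Definition contZ_meet f g : contZ X :=
  ContZ (continuousZ_op2 (fun a b => Num.min a b) (contZ_cont f) (contZ_cont g)).

Definition contZ_join f g : contZ X :=
  ContZ (continuousZ_op2 (fun a b => Num.max a b) (contZ_cont f) (contZ_cont g)).

Fact contZ_lexI f g h : (f <= contZ_meet g h) = (f <= g) && (f <= h).
Proof.
apply/asboolP/andP => [H|[/asboolP H1 /asboolP H2] x]; last first.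
  by rewrite /= le_min H1 H2.
by split; apply/asboolP => x; have := H x; rewrite /= le_min => /andP[].
Qed.

Fact contZ_leUx f g h : (contZ_join f g <= h) = (f <= h) && (g <= h).
Proof.
apply/asboolP/andP => [H|[/asboolP H1 /asboolP H2] x]; last first.
  by rewrite /= ge_max H1 H2.
by split; apply/asboolP => x; have := H x; rewrite /= ge_max => /andP[].
Qed.

Fact contZ_leD2l h f g : f <= g -> h + f <= h + g.
Proof.
move=> /asboolP fg; apply/asboolP => x.
by change (h x + f x <= h x + g x); rewrite lerD2l.
Qed.

HB.instance Definition _ :=
  isLatticeOrderedGroup.Build (contZ X) contZ_lexI contZ_leUx contZ_leD2l.

Lemma contZ_leP f g : reflect (forall x, f x <= g x) (f <= g).
Proof. exact: asboolP. Qed.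

End ContZLGroup.

Arguments contZ_cont {X} f.

Section ContZSpecker.
Context {X : topologicalType} (cX : compact [set: X]).
Implicit Types f g h s : contZ X.

Lemma contZ_bounded f : exists N : nat, forall x, `|f x| <= N%:Z.
Proof.
have /compact_near_coveringP/(_ nat \oo (fun n x => `|f x| <= n%:Z)) := cX.
case=> [x _|N _ fN]; last by exists N => x; exact: (fN N (leqnn N) x I).
have /continuousZP/(_ x) fx := contZ_cont f.
exists ([set y | f y = f x], [set n | (`|f x|%N <= n)%N]) => /=.
  by split=> //; exists `|f x|%N.
by move=> [y n] /= [-> xn]; rewrite -abszE lez_nat.
Qed.

Lemma contZ_mulrnE f n x : (f *+ n) x = f x *+ n.
Proof. by elim: n => [//|n ih]; rewrite !mulrS -ih. Qed.

Lemma contZ_is_unit (u : X -> int) (uP : multispace_unit u) :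
  is_unit (ContZ uP.1 : contZ X).
Proof.
have [cu u0] := uP; split; first by apply/contZ_leP => x; exact/ltW/u0.
move=> g; have [N gN] := contZ_bounded g; exists N.+1 => //.
apply/contZ_leP => x; rewrite contZ_mulrnE.
change (Num.max (g x) (- g x) <= u x *+ N.+1).
rewrite maxrN; apply: (le_trans (gN x)).
have : 1 <= u x by rewrite -gtz0_ge1 u0.
by rewrite -mulr_natl; nia.
Qed.

Lemma contZ_singular s : (forall x, s x = 0 \/ s x = 1) -> singular s.
Proof.
move=> s01; split; first by apply/contZ_leP => x; case: (s01 x) => ->.
move=> a /contZ_leP a0 /contZ_leP sa; apply: contZ_eq => x.
change (Num.min (a x) (s x - a x) = 0).
have := a0 x; have := sa x; change ((0 : contZ X) x) with (0 : int).
by case: (s01 x) => ->; lia.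
Qed.

Lemma contZ_specker : specker (contZ X).
Proof.
rewrite /specker -subTset => f _ H [[H0 HB] sH].
have HN g : H g -> H (- g) by move=> Hg; rewrite -sub0r; exact: HB.
have HD g h : H g -> H h -> H (g + h).
  by move=> Hg Hh; rewrite -[h]opprK; apply: HB => //; exact: HN.
have pos n g : (forall x, 0 <= g x <= n%:Z) -> H g.
  elim: n g => [|n ih] g gn.
    suff -> : g = 0 by [].
    by apply: contZ_eq => x; change (g x = 0); have := gn x; lia.
  pose g' := ContZ (continuousZ_op1 (fun a => Num.min a n%:Z) (contZ_cont g)).
  rewrite -[g](subrK g'); apply: HD.
    apply/sH/contZ_singular => x.
    by change (g x - g' x = 0 \/ g x - g' x = 1); have := gn x; rewrite /=; lia.
  by apply: ih => x; have := gn x; rewrite /=; lia.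
pose fp := ContZ (continuousZ_op1 (fun a => Num.max a 0) (contZ_cont f)).
have [N fN] := contZ_bounded f.
have -> : f = fp - (fp - f) by rewrite opprB addrCA subrr addr0.
apply: HB; apply: (pos N) => x; have := fN x.
  by rewrite /=; lia.
by change (`|f x| <= N%:Z -> 0 <= fp x - f x <= N%:Z); rewrite /=; lia.
Qed.

End ContZSpecker.

(** * The functor from boolean multispaces to unital Specker groups *)

Definition calS_obj (X : bms) : uslg :=
  @Uslg (contZ X) (ContZ (bms_unitP X).1)
    (contZ_is_unit (let: And3 _ cX _ := bms_boolean X in cX) (bms_unitP X))
    (contZ_specker (let: And3 _ cX _ := bms_boolean X in cX)).

Section calS_hom.
Context {W V : bms} (gamma : bms_hom W V).

Fact calS_fun_cont (f : contZ V) :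
  continuousZ (fun w => (f (gamma w) * bms_unit w %/ bms_unit (gamma w))%Z).
Proof.
have cg (h : V -> int) : continuousZ h -> continuousZ (fun w => h (gamma w)).
  move=> /continuousZP ch; apply/continuousZP => w.
  exact: (bms_cont gamma w _ (ch (gamma w))).
apply: (continuousZ_op2 divz).
  apply: (continuousZ_op2 *%R); first exact/cg/contZ_cont.
  exact: (bms_unitP W).1.
exact/cg/(bms_unitP V).1.
Qed.

Definition calS_fun (f : contZ V) : contZ W := ContZ (@calS_fun_cont f).

Lemma calS_funE f w :
  calS_fun f w = f (gamma w) * (bms_unit w %/ bms_unit (gamma w))%Z.
Proof. by rewrite mulz_divA ?bms_dvd. Qed.

Fact calS_fun_lhom : is_lhom calS_fun.
Proof.
have q0 w : 0 <= (bms_unit w %/ bms_unit (gamma w))%Z.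
  by rewrite divz_ge0 ?(ltW ((bms_unitP W).2 w)) ?(bms_unitP V).2.
split=> f g; apply: contZ_eq => w.
- change (calS_fun (f - g) w = calS_fun f w - calS_fun g w).
  by rewrite !calS_funE -mulrBl.
- change (calS_fun (contZ_meet f g) w = Num.min (calS_fun f w) (calS_fun g w)).
  by rewrite !calS_funE -minr_pMl.
- change (calS_fun (contZ_join f g) w = Num.max (calS_fun f w) (calS_fun g w)).
  by rewrite !calS_funE -maxr_pMl.
Qed.

Fact calS_fun_unit :
  calS_fun (uslg_unit (calS_obj V)) = uslg_unit (calS_obj W).
Proof.
apply: contZ_eq => w; rewrite calS_funE /= mulrC divzK //.
exact: bms_dvd.
Qed.

Definition calS_hom : uslg_hom (calS_obj V) (calS_obj W) :=
  @UslgHom (calS_obj V) (calS_obj W) calS_fun calS_fun_lhom calS_fun_unit.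

End calS_hom.

Definition calS : @functor_on Bms (op uSlg) calS_obj.
Proof.
apply: (@FunctorOn Bms (op uSlg) calS_obj (@calS_hom)).
- move=> X; apply: uslg_hom_eq => f; apply: contZ_eq => x.
  by rewrite calS_funE /= divzz (gt_eqF ((bms_unitP X).2 x)) mulr1.
- move=> X Y Z g f; apply: uslg_hom_eq => h; apply: contZ_eq => x.
  rewrite calS_funE [RHS]calS_funE calS_funE /= -mulrA; congr (_ * _).
  have /dvdzP[p px] := bms_dvd f x; have /dvdzP[q qx] := bms_dvd g (f x).
  have nz (T : bms) (y : T) : bms_unit y != 0 by rewrite gt_eqF ?(bms_unitP T).2.
  have -> : (bms_unit x %/ bms_unit (f x))%Z = p by rewrite px mulzK.
  by rewrite px qx mulrA !mulzK // mulrC.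
Defined.

(** * The dual functor on objects *)

Definition is_multispace (X : topologicalType) (u : X -> int) : Prop :=
  boolean_space X /\ multispace_unit u.

(* [calB_obj] takes as argument a proof [wd] that MaxSpec S with the map
   [natural_map u] is a boolean multispace for every (S, u). *)
Definition calB_obj
    (wd : forall S : uslg, is_multispace (natural_map (uslg_unit S))) (S : uslg) :
    bms :=
  Bmspace (wd S).1 (wd S).2.

(* Main.v *)
(* Modulo a prime ideal every singular element becomes 0 or an atom, and all
   atoms coincide; so for a Specker group S and a prime ideal P the quotient S/P
   is a copy of Z, and prime ideals are maximal.  Consequences: MaxSpec(S) is
   compact, because the elements vanishing almost everywhere for an ultrafilter
   of maximal ideals form a prime ideal; the maps g^natural are continuous,
   because this only has to be checked on singular g; they separate the elements
   of S, because Zorn's lemma gives a prime ideal avoiding |g| when g <> 0; and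
   every clopen indicator on MaxSpec(S) is some g^natural, because by compactness
   it is a join of singular elements supported in the clopen set.  On the other
   side, a proper ideal of C_X has a common zero by compactness, and a boolean
   space has a base of clopen sets, so X -> MaxSpec(C_X) is a homeomorphism.
   Naturality and the triangle identities are evaluations, using that for psi :
   S -> T the map rho_m o psi is a multiple of rho_(psi^-1 m), the factor being
   read off at the units. *)

Require Import Defs.
From mathcomp Require Import all_boot all_order all_algebra.
From mathcomp Require Import boolp classical_sets functions topology.
From mathcomp Require Import zify.

Set Implicit Arguments.
Unset Strict Implicit.
Unset Printing Implicit Defensive.

Import Order.TTheory GRing.Theory Num.Theory.
Local Open Scope classical_set_scope.
Local Open Scope ring_scope.

(** * Clopen neighbourhoods in boolean spaces *)

Section BooleanSpaces.
Context {X : topologicalType}.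
Implicit Types (x y : X) (U K O : set X).

Let quasi_component x : set X := [set y | forall K, clopen K -> K x -> K y].

(** If no such [K] exists, the sets K minus O, for [K] clopen around [x], form a filter base; a
    cluster point lies in every such [K] but not in [O]. *)
Lemma clopen_quasi_component_sub x O : compact [set: X] -> open O ->
  quasi_component x `<=` O -> exists K, [/\ clopen K, K x & K `<=` O].
Proof.
move=> cX oO QO; apply: contrapT => noK.
pose D := [set K | clopen K /\ K x].
pose F := filter_from D (fun K => K `\` O).
have FF : ProperFilter F.
  apply: filter_from_proper; first apply: filter_from_filter.
  - by exists setT; split=> //; exact: clopenT.
  - move=> K L [cK Kx] [cL Lx]; exists (K `&` L).
      by split; [exact: clopenI|].
    by move=> y [[]].
  - move=> K [cK Kx]; apply: contrapT => KO; apply: noK; exists K; split=> // y Ky.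
    by apply: contrapT => nOy; apply: KO; exists y.
have [y [_ Fy]] := cX F FF filterT.
have FK K : clopen K -> K x -> closure (K `\` O) y.
  by move=> cK Kx B; apply: Fy; exists K.
have cO : closed (~` O) by exact: open_closedC.
have /QO Oy : quasi_component x y.
  move=> K cK Kx; have [_ /closure_id ->] := cK.
  by move: (FK K cK Kx); apply: closureS => z [].
suff : (~` O) y by [].
rewrite ((closure_id _).1 cO); apply: closureS (FK setT clopenT I).
by move=> z [].
Qed.

Lemma quasi_component_connected x : compact [set: X] -> hausdorff_space X ->
  connected (quasi_component x).
Proof.
move=> cX hX; set Q := quasi_component x.
have Qx : Q x by [].
have cQ : closed Q.
  have -> : Q = \bigcap_(K in [set K | clopen K /\ K x]) K.
    by apply/seteqP; split=> y Qy K; [case; exact: Qy|move=> cK Kx; exact: Qy].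
  by apply: closed_bigI => K [[]].
(* The closed piece missing [x] is empty: normality separates the pieces by [V] and [U], and a
   clopen [K] contained in [V] together with the complement of the closure of [U] has clopen trace
   on [V], which then contains all of [Q]. *)
have key A B : closed A -> closed B -> A x -> Q = A `|` B -> A `&` B = set0 ->
    B = set0.
  move=> cA cB Ax QAB AB0.
  have AnB : A `<=` ~` B by move=> z Az Bz; have : (A `&` B) z by []; rewrite AB0.
  have [U AU UB] : exists2 U, set_nbhs A U & closure U `<=` ~` B.
    apply: (compact_normal hX cX cA); apply/set_nbhsP.
    by exists (~` B); split=> //; exact: closed_openC.
  have [V [oV AV VU]] := (set_nbhsP A U).1 AU.
  have [||K [[oK cK] Kx KVU]] :=
      @clopen_quasi_component_sub x (V `|` ~` closure U) cX.
    by apply: openU => //; apply: closed_openC; exact: closed_closure.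
    rewrite -/Q QAB => z [/AV ?|Bz]; first by left.
    by right=> /UB.
  have KVE : K `&` V = K `&` closure U.
    apply/seteqP; split=> z [Kz].
      by move=> /VU /subset_closure.
    by have [Vz|nUz Uz] := KVU _ Kz.
  have cKV : clopen (K `&` V).
    split; first exact: openI.
    by rewrite KVE; apply: closedI => //; exact: closed_closure.
  rewrite -subset0 => z Bz; have Qz : Q z by rewrite QAB; right.
  have [_ /VU /subset_closure Uz] := Qz _ cKV (conj Kx (AV _ Ax)).
  exact: (UB _ Uz).
move=> B B0 [C oC BC] [C' cC' BC'].
have cB : closed B by rewrite BC'; exact: closedI.
have cB' : closed (Q `&` ~` C) by apply: closedI => //; exact: open_closedC.
have QE : Q = B `|` (Q `&` ~` C).
  by rewrite BC -setIUr setUv setIT.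
have disj : B `&` (Q `&` ~` C) = set0.
  by rewrite BC -subset0 => z [[_ Cz] [_]]; exact.
have [Bx|nBx] := pselect (B x).
  by rewrite [RHS]QE (key B (Q `&` ~` C)) // setU0.
have B'x : (Q `&` ~` C) x by move: (Qx); rewrite {1}QE => -[].
have B00 := key _ _ cB' cB B'x (etrans QE (setUC _ _)) (etrans (setIC _ _) disj).
by case: B0 => z; rewrite B00.
Qed.

(** The quasi-component of [x] is connected, so total disconnectedness shrinks it to the point
    [x]. *)
Lemma boolean_clopen_nbhs x U : boolean_space X -> nbhs x U ->
  exists K, [/\ clopen K, K x & K `<=` U].
Proof.
move=> [tX cX hX]; rewrite nbhsE => -[O [oO Ox] OU].
have QO : quasi_component x `<=` O.
  apply: (@subset_trans _ [set x]); last by move=> _ ->.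
  rewrite -(tX x I); apply: connected_component_max => //.
  exact: quasi_component_connected.
have [K [cK Kx KO]] := clopen_quasi_component_sub cX oO QO.
by exists K; split=> //; exact: subset_trans OU.
Qed.

End BooleanSpaces.

(** * Homomorphisms to the integers *)

Section LHom.
Context {G H : lgroupType} (f : G -> H) (fP : is_lhom f).
Implicit Types x y : G.

Lemma lhomB x y : f (x - y) = f x - f y.
Proof. by case: fP => + _ _; apply. Qed.

Lemma lhom0 : f 0 = 0.
Proof. by rewrite -[X in f X](subrr 0) lhomB subrr. Qed.

Lemma lhomN x : f (- x) = - f x.
Proof. by rewrite -sub0r lhomB lhom0 sub0r. Qed.

Lemma lhomD x y : f (x + y) = f x + f y.
Proof. by rewrite -[y in LHS]opprK lhomB lhomN opprK. Qed.

Lemma lhomMn x n : f (x *+ n) = f x *+ n.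
Proof. by elim: n => [|n ih]; rewrite ?lhom0 // !mulrS lhomD ih. Qed.

Lemma lhom_meet x y : f (x `&` y)%O = (f x `&` f y)%O.
Proof. by case: fP. Qed.

Lemma lhom_join x y : f (x `|` y)%O = (f x `|` f y)%O.
Proof. by case: fP. Qed.

Lemma lhom_le x y : x <= y -> f x <= f y.
Proof. by move=> xy; rewrite -(meet_l xy) lhom_meet; exact: leIr. Qed.

Lemma lhom_ge0 x : 0 <= x -> 0 <= f x.
Proof. by rewrite -lhom0; exact: lhom_le. Qed.

End LHom.

Section LHomInt.
Context {G : lgroupType} (r : G -> int) (rP : is_lhom r).
Implicit Types x y : G.

Lemma lhomZ_min x y : r (x `&` y)%O = Num.min (r x) (r y).
Proof. exact: lhom_meet. Qed.

Lemma lhomZ_max x y : r (x `|` y)%O = Num.max (r x) (r y).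
Proof. exact: lhom_join. Qed.

Lemma lhomZ_abs x : r (labs x) = `|r x|.
Proof. by rewrite lhomZ_max (lhomN rP) maxrN. Qed.

Lemma lhomZ_ker_maximal e : r e != 0 -> maximal_ideal (r @^-1` [set 0]).
Proof.
move=> re; split; first split.
- split=> [|x y] /=; first exact: (lhom0 rP).
  by rewrite (lhomB rP) => -> ->; rewrite subrr.
- by move=> x y /= rx ry; rewrite lhomZ_min lhomZ_max rx ry minxx maxxx.
- move=> a x y /= rx ry /(lhom_le rP) + /(lhom_le rP).
  by rewrite rx ry => ? ?; apply/eqP; rewrite eq_le; apply/andP.
- by apply/eqP => rT; have /eqP : (r @^-1` [set 0]) e; [rewrite rT|exact/negP].
move=> J iJ rJ; apply/seteqP; split=> // y Jy; apply: contrapT => /eqP ry.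
case: (iJ) => _ _ _ /eqP; apply; rewrite -subTset => g _.
apply: (ideal_absE iJ).
(* Since |r y| >= 1, this multiple of |y| dominates |g| under [r]: hence [r] kills |g| - z, while
   [z] lies in [J] by convexity. *)
pose z := (labs g `&` (labs y *+ `|r g|%N))%O.
suff Jz : J (labs g - z).
  rewrite -(subrK z (labs g)); apply: (idealD iJ) => //.
  apply: (ideal_le iJ (idealMn `|r g|%N iJ (ideal_abs iJ Jy))); last exact: leIr.
  by rewrite lexI lg_abs_ge0 lgMn_ge0 ?lg_abs_ge0.
apply: rJ; rewrite /= (lhomB rP) /z lhomZ_min (lhomMn rP) !lhomZ_abs.
have : 1 <= `|r y| by rewrite -gtz0_ge1 normr_gt0.
rewrite -mulr_natl; nia.
Qed.

(* A homomorphism killing the kernel of a surjective one is a multiple of it,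
   the factor being its value at a positive preimage of 1. *)
Lemma lhomZ_factor (r' : G -> int) : is_lhom r' -> range r = setT ->
  (forall g, r g = 0 -> r' g = 0) ->
  exists2 d, 0 <= d & forall g, r' g = d * r g.
Proof.
move=> r'P rT rr'; have : range r 1 by rewrite rT.
case=> e0 _ e01; pose e := labs e0.
have e1 : r e = 1 by rewrite lhomZ_abs e01.
have MzE (h : G -> int) n : is_lhom h -> h (e *~ n) = h e * n.
  move=> hP; case: n => n; first by rewrite -pmulrn (lhomMn hP) -mulr_natr natz.
  by rewrite NegzE mulrNz -pmulrn (lhomN hP) (lhomMn hP) mulrN -mulr_natr natz.
exists (r' e); first exact: (lhom_ge0 r'P (lg_abs_ge0 e0)).
move=> g; have : r (g - e *~ r g) = 0 by rewrite (lhomB rP) (MzE _ _ rP) e1 mul1r subrr.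
by move/rr'; rewrite (lhomB r'P) (MzE _ _ r'P) => /eqP; rewrite subr_eq0 => /eqP.
Qed.

End LHomInt.

(** By [lhomZ_factor], [r'] is a nonnegative multiple of [r]; as [r'] takes the value 1, the factor
    divides 1. *)
Lemma lhomZ_ker_inj (G : lgroupType) (r r' : G -> int) :
  is_lhom r -> is_lhom r' -> range r = setT -> range r' = setT ->
  r @^-1` [set 0] = r' @^-1` [set 0] -> r = r'.
Proof.
move=> rP r'P rT r'T kerE.
have kE g : r g = 0 <-> r' g = 0.
  by have := congr1 (fun A => A g) kerE; rewrite /= => ->.
have [d d0 r'E] := lhomZ_factor rP r'P rT (fun g => (kE g).1).
have : range r' 1 by rewrite r'T.
case=> e _; rewrite r'E => de1.
have : (d %| 1%R)%Z by rewrite -de1 dvdz_mulr.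
rewrite dvdz1 => /eqP d1'; have d1 : d = 1 by lia.
by apply/funext => g; rewrite r'E d1 mul1r.
Qed.

(** * Prime ideals of Specker groups *)

Lemma subrACA (V : zmodType) (a b c d : V) : (a - b) - (c - d) = (a - c) - (b - d).
Proof. by rewrite !opprB addrACA [- b - c]addrC -addrACA. Qed.

Section SpeckerPrime.
Context {G : lgroupType}.
Implicit Types (a b g h s t x y : G) (I : set G) (m : maxSpec G).

Definition prime_ideal I : Prop :=
  ideal I /\ forall a b, 0 <= a -> 0 <= b -> I (a `&` b)%O -> I a \/ I b.

Lemma maximal_ideal_prime I : maximal_ideal I -> prime_ideal I.
Proof. by move=> mI; split; [case: mI|move=> a b; exact: maximal_prime]. Qed.

Lemma lg_subr_ge0 x y : (0 <= y - x) = (x <= y).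
Proof. by rewrite -[LHS](lgD2r x) subrK add0r. Qed.

Lemma lg_meetB x y : ((x - x `&` y) `&` (y - x `&` y))%O = 0.
Proof. by rewrite -lgDIr subrr. Qed.

Lemma lg_joinE x y : (x `|` y)%O = x + y - (x `&` y)%O.
Proof.
apply/eqP; rewrite eq_le; apply/andP; split.
  by rewrite leUx -!addrA -{1}[x]addr0 lgD2l lg_subr_ge0 leIr /= addrCA
    -{1}[y]addr0 lgD2l lg_subr_ge0 leIl.
(* The other inequality: x + y minus the join is a lower bound of both [x] and [y]. *)
rewrite -(lgD2r (x `&` y)%O) subrK -(lgD2l (- (x `|` y)%O)) addKr.
rewrite lexI; apply/andP; split.
  rewrite -(lgD2l (x `|` y)%O) addrA addrA addrN add0r addrC.
  by rewrite lgD2r leUr.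
rewrite -(lgD2l (x `|` y)%O) addrA addrA addrN add0r.
by rewrite lgD2r leUl.
Qed.

(** Induction principle: a property stable under differences need only be checked on singular
    elements. *)
Lemma specker_subgroup (P : set G) : specker G -> subgroup P ->
  @singular G `<=` P -> forall g, P g.
Proof.
move=> spG sgP sP g; have : [set: G] g by [].
by rewrite -spG; apply.
Qed.

Lemma specker_singular_notin I : specker G -> ideal I ->
  exists2 s, singular s & ~ I s.
Proof.
move=> spG iI; case: (iI) => sgI _ _ /eqP IT; apply: contrapT => nos; apply: IT.
rewrite -subTset => g _; apply: (specker_subgroup spG sgI) => s ss.
by apply: contrapT => nIs; apply: nos; exists s.
Qed.

(** By singularity the meet of [s] and [t] is disjoint from both remainders, and the remainders are
    disjoint from each other. Primality keeps the meet out of [I], hence puts both remainders in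
    [I]. *)
Lemma singular_congr I s t : prime_ideal I -> singular s -> singular t ->
  ~ I s -> ~ I t -> I (s - t).
Proof.
move=> [iI pI] [s0 ss] [t0 st] nIs nIt.
have st0 : (0 <= s `&` t)%O by rewrite lexI s0.
have ds : 0 <= s - (s `&` t)%O by rewrite lg_subr_ge0 leIl.
have dt : 0 <= t - (s `&` t)%O by rewrite lg_subr_ge0 leIr.
have disj z : singular z -> ~ I z -> (s `&` t)%O <= z ->
    I (z - (s `&` t)%O) \/ I (s `&` t)%O.
  move=> [z0 sz] nIz stz.
  have dz : 0 <= z - (s `&` t)%O by rewrite lg_subr_ge0.
  have [] := pI (s `&` t)%O (z - (s `&` t)%O) st0 dz; try by [left|right].
  by rewrite sz //; exact: ideal0.
have nIst : ~ I (s `&` t)%O.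
  move=> Ist; have [] := pI _ _ ds dt; first by rewrite lg_meetB; exact: ideal0.
    by move=> h; apply: nIs; rewrite -(subrK (s `&` t)%O s); exact: idealD.
  by move=> h; apply: nIt; rewrite -(subrK (s `&` t)%O t); exact: idealD.
have [Is|//] := disj s (conj s0 ss) nIs (leIl _ _).
have [It|//] := disj t (conj t0 st) nIt (leIr _ _).
by have := idealB iI Is It; rewrite opprB addrA subrK.
Qed.

(** Modulo [I], every [g] is a unique integer multiple of a fixed singular [s] outside [I]; this
    integer is [r g]. *)
Lemma specker_prime_lhom I : specker G -> prime_ideal I ->
  exists r : G -> int, [/\ is_lhom r, range r = setT & r @^-1` [set 0] = I].
Proof.
move=> spG pI; have [iI prI] := pI.
have [s ss nIs] := specker_singular_notin spG iI; have s0 := ss.1.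
have sMz0 n : I (s *~ n) -> n = 0.
  have nat0 k : I (s *+ k.+1) -> False.
    move=> Isk; apply: nIs; apply: (ideal_le iI Isk) => //.
    by rewrite mulrS -{1}[s]addr0 lgD2l lgMn_ge0.
  case: n => [[//|n]|n]; first by rewrite -pmulrn => /nat0.
  by rewrite NegzE mulrNz -pmulrn => /(idealN iI); rewrite opprK => /nat0.
have ex g : exists n : int, I (g - s *~ n).
  apply: (@specker_subgroup [set g | exists n : int, I (g - s *~ n)] spG) => {g}.
    split; first by exists 0; rewrite mulr0z subr0; exact: ideal0.
    move=> x y [n In] [k Ik]; exists (n - k).
    by rewrite mulrzBr subrACA; exact: idealB.
  move=> t st; have [It|nIt] := pselect (I t).
    by exists 0; rewrite mulr0z subr0.
  by exists 1; rewrite mulr1z; exact: singular_congr.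
have [r rE] := choice ex.
have rU g n : I (g - s *~ n) -> r g = n.
  move=> Ign; have := idealB iI Ign (rE g); rewrite subrACA subrr sub0r opprB.
  by rewrite -mulrzBr => /sMz0 /eqP; rewrite subr_eq0 => /eqP.
have rB g h : r (g - h) = r g - r h.
  by apply: rU; rewrite mulrzBr subrACA; apply: idealB.
have rN g : r (- g) = - r g.
  by rewrite -sub0r rB -[X in r X](subrr 0) rB subrr sub0r.
have rD g h : r (g + h) = r g + r h by rewrite -{1}[h]opprK rB rN opprK.
(* If [r g] were -(n+1), then g + (n+1)s would lie in [I] and dominate [s]. *)
have r_ge0 g : 0 <= g -> 0 <= r g.
  move=> g0; case rg: (r g) => [//|n]; exfalso; have := rE g.
  rewrite rg NegzE mulrNz opprK -pmulrn => Ign.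
  apply: nIs; apply: (ideal_le iI Ign) => //.
  by rewrite mulrS addrCA -{1}[s]addr0 lgD2l lgD_ge0 ?lgMn_ge0.
have rI g : r g = 0 <-> I g.
  split=> [rg|Ig]; last by apply: rU; rewrite mulr0z subr0.
  by have := rE g; rewrite rg mulr0z subr0.
have r_le g h : g <= h -> r g <= r h.
  by rewrite -lg_subr_ge0 => /r_ge0; rewrite rB subr_ge0.
have rmeet g h : r (g `&` h)%O = Num.min (r g) (r h).
  have rg := r_le _ _ (leIl g h); have rh := r_le _ _ (leIr h g).
  (* The remainders are disjoint, so one of them lies in [I]: the value at the meet is [r g] or
     [r h], and by monotonicity the smaller one. *)
  have : I (g - (g `&` h)%O) \/ I (h - (g `&` h)%O).
    apply: prI; rewrite ?lg_subr_ge0 ?leIl ?leIr// lg_meetB.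
    exact: ideal0.
  by case=> /rI /eqP; rewrite rB subr_eq0 => /eqP; lia.
exists r; split.
- split=> x y; [exact: rB|exact: rmeet|].
  rewrite lg_joinE rB rD rmeet.
  change (r x + r y - Num.min (r x) (r y) = Num.max (r x) (r y)); lia.
- rewrite -subTset => n _; exists (s *~ n) => //.
  by apply: rU; rewrite subrr; exact: ideal0.
- by apply/seteqP; split=> g /=; move/rI.
Qed.

Lemma specker_prime_maximal I : specker G -> prime_ideal I -> maximal_ideal I.
Proof.
move=> spG /(specker_prime_lhom spG)[r [rP rT <-]].
have : range r 1 by rewrite rT.
by case=> e _ re; apply: (lhomZ_ker_maximal rP (e := e)); rewrite re.
Qed.

(** * The homomorphism onto the integers attached to a maximal ideal *)

Section Rho.
Hypothesis spG : specker G.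

(** Since such a homomorphism exists, the default value in [rho] never occurs. *)
Let rhoP m : [/\ is_lhom (rho m), range (rho m) = setT &
  rho m @^-1` [set 0] = max_ideal m].
Proof.
have := specker_prime_lhom spG (maximal_ideal_prime (max_idealP m)).
exact: (@xgetPex _ (fun=> 0)
  [set r | [/\ is_lhom r, range r = setT & r @^-1` [set 0] = max_ideal m]]).
Qed.

Lemma rho_lhom m : is_lhom (rho m).
Proof. by case: (rhoP m). Qed.

Lemma rho_range m : range (rho m) = setT.
Proof. by case: (rhoP m). Qed.

Lemma rho_ker m : rho m @^-1` [set 0] = max_ideal m.
Proof. by case: (rhoP m). Qed.

Lemma rho0P m g : rho m g = 0 <-> max_ideal m g.
Proof. by rewrite -rho_ker. Qed.

Lemma rho_unique m (r : G -> int) : is_lhom r -> range r = setT ->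
  r @^-1` [set 0] = max_ideal m -> r = rho m.
Proof.
move=> rP rT kr; apply: lhomZ_ker_inj => //; [exact: rho_lhom|exact: rho_range|].
by rewrite rho_ker.
Qed.

(** All singular elements outside [m] have the same value by [singular_congr]; it divides every
    value of [rho m], hence also 1. *)
Lemma rho_singular m s : singular s -> ~ max_ideal m s -> rho m s = 1.
Proof.
move=> ss nms; have : range (rho m) 1 by rewrite rho_range.
case=> e0 _ e01.
pose d := rho m s; have rP := rho_lhom m.
have dv : forall g, exists k, rho m g = k * d.
  apply: (@specker_subgroup [set g | exists k, rho m g = k * d] spG).
    split; first by exists 0; rewrite (lhom0 rP) mul0r.
    by move=> x y [k xk] [l yl]; exists (k - l); rewrite (lhomB rP) xk yl mulrBl.
  move=> t st; have [/rho0P mt|nmt] := pselect (max_ideal m t).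
    by exists 0; rewrite mt mul0r.
  exists 1; rewrite mul1r; apply/eqP; rewrite -subr_eq0 -(lhomB rP); apply/eqP/rho0P.
  exact: (singular_congr (maximal_ideal_prime (max_idealP m))).
have [k] := dv e0; rewrite e01 => kd.
have d0 : 0 <= d by apply: (lhom_ge0 rP); case: ss.
have : (d %| 1%R)%Z by rewrite kd dvdz_mull.
by rewrite dvdz1 => /eqP; rewrite -/d; lia.
Qed.

End Rho.
End SpeckerPrime.

(** * The maximal spectrum *)

Lemma maxSpec_eq (G : lgroupType) (m m' : maxSpec G) :
  max_ideal m = max_ideal m' -> m = m'.
Proof.
case: m m' => I mI [J mJ] /= IJ; case: _ / IJ in mJ *.
by congr MaxSpec; exact: Prop_irrelevance.
Qed.

Lemma maxSpec_nbhsP (G : lgroupType) (m : maxSpec G) (A : set (maxSpec G)) :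
  nbhs m A <->
  exists2 g, ~ max_ideal m g & [set m' | ~ max_ideal m' g] `<=` A.
Proof.
split=> [|[g mg gA]].
  rewrite nbhsE => -[B [[D Dbase <-] [U DU Um]] BA].
  have [g _ gU] := Dbase U DU; exists g; first by move: Um; rewrite -gU.
  by move=> m' m'g; apply: BA; exists U => //; rewrite -gU.
apply: filterS gA _; apply: open_nbhs_nbhs; split=> //.
exists [set [set m' : maxSpec G | ~ max_ideal m' g]].
  by move=> _ ->; exists g.
by rewrite bigcup_set1.
Qed.

Section MaxSpecSpecker.
Context {G : lgroupType} (spG : specker G).
Implicit Types (a b g h s t x y : G) (m : maxSpec G).

Let natural_mapB x y :
  natural_map (x - y) = fun m => natural_map x m - natural_map y m.
Proof. by apply/funext => m; exact: (lhomB (rho_lhom spG m)). Qed.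

(* For a singular [t] outside [m], the element [t - t `&` s] cuts out a
   neighbourhood of [m] on which [s] vanishes as soon as [s] vanishes at [m]. *)
Lemma natural_map_cont g : continuousZ (natural_map g).
Proof.
apply: (@specker_subgroup _ [set g | continuousZ (natural_map g)] spG) => {g}.
  split=> [|x y cx cy] /=.
    have -> : natural_map (0 : G) = fun=> 0.
      by apply/funext => m; exact: (lhom0 (rho_lhom spG m)).
    exact: continuousZ_cst.
  by rewrite natural_mapB; exact: (continuousZ_op2 (fun p q => p - q) cx cy).
move=> s ss; apply/continuousZP => m; apply/maxSpec_nbhsP.
have [ms|nms] := pselect (max_ideal m s); last first.
  exists s => // m' nm's /=.
  by rewrite /natural_map !(rho_singular spG ss).
have [t st nmt] := specker_singular_notin spG (max_idealP m).1.
have [s0 _] := ss; have [t0 tt] := st.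
have ts0 : (0 <= t `&` s)%O by rewrite lexI t0.
have dt : 0 <= t - (t `&` s)%O by rewrite lg_subr_ge0 leIl.
have ds : 0 <= s - (t `&` s)%O by rewrite lg_subr_ge0 leIr.
have mts : max_ideal m (t `&` s)%O.
  by apply: (ideal_le (max_idealP m).1 ms) => //; exact: leIr.
exists (t - (t `&` s)%O).
  move=> /(idealD (max_idealP m).1) /(_ mts); rewrite subrK; exact: nmt.
move=> m' /= nm'; have [iM pM] := maximal_ideal_prime (max_idealP m').
suff m's : max_ideal m' s.
  by rewrite /natural_map ((rho0P spG m' s).2 m's) ((rho0P spG m s).2 ms).
have m'ts : max_ideal m' (t `&` s)%O.
  have [|//|//] := pM _ _ ts0 dt.
  by rewrite tt ?leIl//; exact: ideal0.
have [|//|m'd] := pM _ _ dt ds; first by rewrite lg_meetB; exact: ideal0.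
by rewrite -(subrK (t `&` s)%O s); exact: idealD.
Qed.

(** Closedness is built into the topology; openness is local constancy of [natural_map g] at its
    zeros. *)
Lemma maxSpec_clopen g : clopen [set m | max_ideal m g].
Proof.
split; last first.
  rewrite -[X in closed X]setCK; apply: open_closedC.
  rewrite openE => m mg; apply/maxSpec_nbhsP; by exists g.
rewrite openE => m mg; have /continuousZP/(_ m) := @natural_map_cont g.
apply: filterS => m' /=; rewrite /natural_map ((rho0P spG m g).2 mg).
by move/rho0P; apply.
Qed.

Lemma maxSpec_separated m m' : m != m' ->
  exists2 g, max_ideal m g & ~ max_ideal m' g.
Proof.
move=> mm'; apply: contrapT => no; move/eqP: mm'; apply; apply: maxSpec_eq.
apply/esym; apply: (max_idealP m).2; first exact: (max_idealP m').1.
by move=> g mg; apply: contrapT => m'g; apply: no; exists g.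
Qed.

Lemma maxSpec_zero_dimensional : zero_dimensional (maxSpec G).
Proof.
move=> m m' /maxSpec_separated[g mg m'g].
by exists [set m | max_ideal m g]; split=> //; exact: maxSpec_clopen.
Qed.

Lemma maxSpec_hausdorff : hausdorff_space (maxSpec G).
Proof.
rewrite open_hausdorff => m m' /maxSpec_separated[g mg m'g].
have [oA cA] := maxSpec_clopen g.
exists ([set m | max_ideal m g], ~` [set m | max_ideal m g]) => /=.
  by rewrite !inE.
by split=> //; [exact: closed_openC|rewrite setICr].
Qed.

(* The limit of an ultrafilter F is the set of g vanishing F-almost everywhere. *)
Lemma maxSpec_compact (u : G) : is_unit u -> compact [set: maxSpec G].
Proof.
move=> [u0 uP]; rewrite compact_ultra => F FU _.
pose I : set G := [set g | F [set m | max_ideal m g]].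
have FI2 x y z : I x -> I y ->
    (forall m, max_ideal m x -> max_ideal m y -> max_ideal m z) -> I z.
  by move=> Ix Iy h; apply: filterS2 Ix Iy => m; exact: h.
have nIu : ~ I u.
  move=> Iu; have [m /= mu] := filter_ex Iu.
  have [iM _] := max_idealP m; case: (iM) => _ _ _ /eqP; apply.
  rewrite -subTset => g _; have [n _ gn] := uP g.
  apply: (ideal_absE iM); apply: (ideal_le iM (idealMn n iM mu)) => //.
  exact: lg_abs_ge0.
have pI : prime_ideal I.
  split; first split.
  - split; first by apply: filterE => m; exact: ideal0 (max_idealP m).1.
    by move=> x y Ix Iy; apply: FI2 Ix Iy _ => m; apply: idealB; case: (max_idealP m).
  - by move=> x y Ix Iy; split; apply: (FI2 _ _ _ Ix Iy) => m mx my;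
      have [[_ h _ _] _] := max_idealP m; case: (h x y mx my).
  - move=> a x y Ix Iy xa ay; apply: FI2 Ix Iy _ => m mx my.
    by have [[_ _ h _] _] := max_idealP m; exact: (h a x y).
  - by apply/eqP => IT; apply: nIu; rewrite IT.
  move=> a b a0 b0 Iab; have [Ia|nFa] := in_ultra_setVsetC [set m | max_ideal m a] FU.
    by left.
  right; apply: filterS2 Iab nFa => m /= mab nma.
  by have [] := maximal_prime (max_idealP m) a0 b0 mab.
exists (MaxSpec (specker_prime_maximal spG pI)); split=> //= A.
move=> /maxSpec_nbhsP[g /= nIg gA].
have [//|] := in_ultra_setVsetC [set m | max_ideal m g] FU.
exact: filterS.
Qed.

End MaxSpecSpecker.

(** If [rho m] killed the unit it would kill every element, against surjectivity. *)
Lemma rho_unit_gt0 (S : uslg) (m : maxSpec S) : 0 < rho m (uslg_unit S).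
Proof.
have [u0 uP] := uslg_is_unit S; have spS := uslg_specker S.
have rP := rho_lhom spS m; rewrite lt_neqAle (lhom_ge0 rP u0) andbT eq_sym.
apply/eqP => ru; have : range (rho m) 1 by rewrite rho_range.
case=> e _ e1; have [n _] := uP e.
move/(lhom_le rP); rewrite (lhomMn rP) ru mul0rn (lhomZ_abs rP) e1.
by rewrite normr1.
Qed.

Lemma maxSpec_multispace (S : uslg) : is_multispace (natural_map (uslg_unit S)).
Proof.
have spS := uslg_specker S; split.
  split; last exact: maxSpec_hausdorff.
    exact/zero_dimension_totally_disconnected/maxSpec_zero_dimensional.
  exact: (maxSpec_compact spS (uslg_is_unit S)).
by split; [exact: natural_map_cont|exact: rho_unit_gt0].
Qed.

(** * Representation of Specker groups by integer-valued functions *)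

Section PrimeAvoidance.
Context {G : lgroupType}.
Implicit Types (a b x y z : G) (I : set G).

(** This bound gives both lattice closure and convexity of [ideal_adjoin]. *)
Lemma labs_between x y z : (x `&` y <= z)%O -> (z <= x `|` y)%O ->
  labs z <= labs x + labs y.
Proof.
have lel v w : v <= labs v + labs w.
  by rewrite -[v in leLHS]addr0; apply: lgD; rewrite ?lg_abs_ge ?lg_abs_ge0.
have leN v w : - v <= labs v + labs w.
  by rewrite -[- v in leLHS]addr0; apply: lgD; rewrite ?lg_abs_geN ?lg_abs_ge0.
move=> xyz zxy; rewrite {1}/labs leUx; apply/andP; split.
  by apply: (le_trans zxy); rewrite leUx lel /= addrC lel.
rewrite -lgN2 opprK; apply: le_trans xyz.
by rewrite lexI -lgN2 opprK leN /= -lgN2 opprK addrC leN.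
Qed.

Lemma labsB x y : labs (x - y) <= labs x + labs y.
Proof.
rewrite {1}/labs leUx; apply/andP; split; first by rewrite lgD ?lg_abs_ge ?lg_abs_geN.
by rewrite opprB addrC lgD ?lg_abs_ge ?lg_abs_geN.
Qed.

(** For an ideal [I] and [x >= 0], the convex l-subgroup generated by [I] and [x], possibly
    everything. *)
Definition ideal_adjoin I x : set G :=
  [set z | exists p n, [/\ I p, 0 <= p & labs z <= p + x *+ n]].

Lemma ideal_adjoinP I x b : ideal I -> 0 <= x -> ~ ideal_adjoin I x b ->
  ideal (ideal_adjoin I x).
Proof.
move=> iI x0 nJb.
have J2 v w z : ideal_adjoin I x v -> ideal_adjoin I x w ->
    labs z <= labs v + labs w -> ideal_adjoin I x z.
  move=> [p [n [Ip p0 vp]]] [q [k [Iq q0 wq]]] zvw.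
  exists (p + q), (n + k)%N; split; [exact: idealD|exact: lgD_ge0|].
  by apply: (le_trans zvw); rewrite mulrnDr addrACA; exact: lgD.
split; first split.
- exists 0, 0%N; split; [exact: ideal0|by []|].
  by rewrite mulr0n addr0 /labs oppr0 joinxx.
- by move=> v w Jv Jw; apply: J2 Jv Jw _; exact: labsB.
- move=> v w Jv Jw; split; apply: J2 Jv Jw _; apply: labs_between => //.
    exact: le_trans (leIl _ _) (leUl _ _).
  exact: le_trans (leIl _ _) (leUl _ _).
- move=> z v w Jv Jw vz zw; apply: J2 Jv Jw _; apply: labs_between.
    by apply: le_trans vz; exact: leIl.
  by apply: (le_trans zw); exact: leUr.
- by apply/eqP => JT; apply: nJb; rewrite JT.
Qed.

(** Take [I] maximal among the ideals avoiding [a]. If [x] and [y] are both outside [I], then a <= p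
    + nx and a <= q + ky, so [a] is at most p + q plus the meet of nx and ky; if the meet of [x] and
    [y] were in [I], so would be [a]. *)
Lemma prime_ideal_avoiding a : 0 <= a -> a != 0 ->
  exists2 I : set G, prime_ideal I & ~ I a.
Proof.
move=> a0 an0.
pose P (I : set G) := I = set0 \/ ideal I /\ ~ I a.
have PU F : F `<=` P -> total_on F subset -> P (\bigcup_(X in F) X).
  move=> FP totF.
  have [[z [X FX Xz]]|U0] := pselect ((\bigcup_(X in F) X) !=set0); last first.
    by left; apply/eqP; apply/negPn/negP => /set0P.
  have FI Y y : F Y -> Y y -> ideal Y /\ ~ Y a.
    by move=> /FP [->|] //.
  (* Two elements of the union of a chain already lie in a common member. *)
  have U2 x y (Q : G -> Prop) : (\bigcup_(X in F) X) x -> (\bigcup_(X in F) X) y ->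
      (forall Y, F Y -> ideal Y -> Y x -> Y y -> Q x) -> Q x.
    move=> [Y FY Yx] [Z FZ Zy] h.
    have [YZ|ZY] := totF Y Z FY FZ.
      by apply: (h Z) => //; [exact: (FI Z y FZ Zy).1|exact: YZ].
    by apply: (h Y) => //; [exact: (FI Y x FY Yx).1|exact: ZY].
  right; split; last by case=> Y FY Ya; have [_] := FI Y a FY Ya.
  split; first split.
  - by exists X => //; apply: ideal0; exact: (FI X z FX Xz).1.
  - move=> x y Ux Uy; apply: (U2 x y (fun=> _) Ux Uy) => Y FY iY Yx Yy.
    by exists Y => //; exact: idealB.
  - move=> x y Ux Uy; apply: (U2 x y (fun=> _) Ux Uy) => Y FY iY Yx Yy.
    by have [_ h _ _] := iY; have [] := h x y Yx Yy; split; exists Y.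
  - move=> t x y Ux Uy xt ty; apply: (U2 x y (fun=> _) Ux Uy) => Y FY iY Yx Yy.
    by exists Y => //; have [_ _ h _] := iY; exact: (h t x y).
  - apply/eqP => UT; have : (\bigcup_(X in F) X) a by rewrite UT.
    by case=> Y FY Ya; have [_] := FI Y a FY Ya.
have [I [PI maxI]] := Zorn_bigcup PU.
have [iI nIa] : ideal I /\ ~ I a.
  case: PI => // I0; exfalso; apply: (maxI [set 0]).
    by rewrite I0; split=> // /(_ 0 erefl).
  right; split; last by move=> /eqP; rewrite (negbTE an0).
  split; first split.
  - by [].
  - by move=> x y -> ->; rewrite /= subr0.
  - by move=> x y -> ->; rewrite /= meetxx joinxx.
  - by move=> z x y -> -> ? ?; apply/eqP; rewrite eq_le; apply/andP.
  - apply/eqP => T; have : [set 0] a by rewrite T.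
    by move=> /eqP; rewrite (negbTE an0).
exists I => //; split=> // x y x0 y0 Ixy.
have adj z : 0 <= z -> ~ I z -> ideal_adjoin I z a.
  move=> z0 nIz; apply: contrapT => nJa; apply: (maxI (ideal_adjoin I z)).
    split.
      move=> v Iv; exists (labs v), 0%N; rewrite mulr0n addr0.
      by split; [exact: ideal_abs|exact: lg_abs_ge0|].
    move=> JI; apply: nIz; apply: JI; exists 0, 1%N.
    split; [exact: ideal0|by []|rewrite add0r mulr1n /labs leUx lexx /=].
    by apply: (le_trans _ z0); rewrite -lgN2 opprK oppr0.
  by right; split=> //; exact: ideal_adjoinP iI z0 nJa.
apply: contrapT => /not_orP[/(adj _ x0) Jx /(adj _ y0) Jy].
have [[p [n [Ip p0 ap]]] [q [k [Iq q0 aq]]]] := (Jx, Jy).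
apply: nIa; pose w := ((x *+ n) `&` (y *+ k))%O.
have w0 : 0 <= w by rewrite lexI !lgMn_ge0.
(* [w] is at most nk times the meet of [x] and [y], by [lg_meetMn] in each argument. *)
have Iw : I w.
  apply: (ideal_le iI (idealMn k iI (idealMn n iI Ixy))) => //.
  apply: (le_trans (lg_meetMn k (lgMn_ge0 n x0) y0)).
  have meet_mul : ((x *+ n) `&` y <= (x `&` y) *+ n)%O.
    by rewrite [((x *+ n) `&` y)%O]meetC [(x `&` y)%O]meetC; exact: lg_meetMn.
  by elim: k {aq w w0 } => [//|k ih]; rewrite !mulrS; exact: lgD.
apply: (ideal_le iI (idealD iI (idealD iI Ip Iq) Iw)) => //.
rewrite addrC lgDIr lexI; apply/andP; split.
apply: (le_trans (lg_abs_ge a)); apply: (le_trans ap); rewrite addrC lgD2l.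
  by rewrite -{1}[p]addr0 lgD2l.
apply: (le_trans (lg_abs_ge a)); apply: (le_trans aq); rewrite addrC lgD2l.
by rewrite -{1}[q]add0r lgD2r.
Qed.

End PrimeAvoidance.

(** * Clopen sets and integer-valued functions *)

Section ContZClopen.
Context {X : topologicalType}.

Lemma contZ_clopen (f : contZ X) (A : set int) : clopen (f @^-1` A).
Proof.
have oA (B : set int) : open (f @^-1` B).
  rewrite openE => x Bx; have /continuousZP/(_ x) := contZ_cont f.
  by apply: filterS => y /= fy; rewrite /preimage /= fy.
by split=> //; rewrite -[X in closed X]setCK; apply: open_closedC; exact: (oA (~` A)).
Qed.

Lemma contZ_indicator (K : set X) : clopen K ->
  exists f : contZ X, forall x, f x = (x \in K)%:R.
Proof.
move=> [oK cK].
suff cf : continuousZ (fun x : X => (x \in K)%:R : int) by exists (ContZ cf).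
apply/continuousZP => x; have [xK|xK] := boolP (x \in K).
  apply: filterS (open_nbhs_nbhs (conj oK (set_mem xK))) => y Ky /=.
  by rewrite mem_set.
have oC : open (~` K) by exact: closed_openC.
have nKx : (~` K) x by move=> Kx; rewrite mem_set in xK.
apply: filterS (open_nbhs_nbhs (conj oC nKx)) => y nKy /=.
by rewrite memNset.
Qed.

Lemma contZ_singular01 (s : contZ X) : singular s -> forall x, s x = 0 \/ s x = 1.
Proof.
move=> [/contZ_leP s0 ss] x.
(* Singularity is tested on min(s, 1): where s x >= 2, both [a] and s - a are at least 1. *)
pose a : contZ X := ContZ (continuousZ_op1 (fun n => Num.min n 1) (contZ_cont s)).
have a0 : 0 <= a.
  apply/contZ_leP => y; have := s0 y; change ((0 : contZ X) y) with (0 : int).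
  by rewrite /=; lia.
have as_ : a <= s by apply/contZ_leP => y; rewrite /=; lia.
have := congr1 (fun f : contZ X => f x) (ss a a0 as_).
change (Num.min (Num.min (s x) 1) (s x - Num.min (s x) 1) = 0 -> s x = 0 \/ s x = 1).
by have := s0 x; change ((0 : contZ X) x) with (0 : int); lia.
Qed.

End ContZClopen.

(** If [g] is nonzero, some prime ideal avoids |g|; it is maximal, and [rho] there does not kill
    [g]. *)
Lemma natural_map_inj (G : lgroupType) (g : G) : specker G ->
  (forall m : maxSpec G, rho m g = 0) -> g = 0.
Proof.
move=> spG rg0; apply/eqP; apply: contrapT => /negP gn0.
have an0 : labs g != 0.
  apply: contra gn0 => /eqP ag0; have := lg_abs_geN g; have := lg_abs_ge g.
  by rewrite ag0 eq_le => -> /=; rewrite -lgN2 oppr0 opprK.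
have [I pI nIg] := prime_ideal_avoiding (lg_abs_ge0 g) an0.
apply: nIg; apply: (ideal_abs pI.1).
exact/(rho0P spG (MaxSpec (specker_prime_maximal spG pI)))/rg0.
Qed.

(** * Realising continuous functions on the spectrum *)

Section NaturalMapImage.
Context {G : lgroupType} (spG : specker G) (cG : compact [set: maxSpec G]).
Implicit Types (g h s : G) (m : maxSpec G) (K : set (maxSpec G)).

(** The elements whose function on the spectrum is the indicator of a subset of [K]. *)
Let below K : set G := [set g | forall m, rho m g = 0 \/ rho m g = 1 /\ K m].

Let below_join K g h : below K g -> below K h -> exists2 k, below K k &
  forall m, rho m g = 1 \/ rho m h = 1 -> rho m k = 1.
Proof.
move=> gK hK; have maxE m := lhomZ_max (rho_lhom spG m) g h.
exists (g `|` h)%O => m; rewrite maxE.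
  by case: (gK m) (hK m) => [->|[-> ?]] [->|[-> ?]]; [left|right..].
by case: (gK m) (hK m) => [->|[-> _]] [->|[-> _]] [].
Qed.

(** A singular [s] outside [m] has values 0 and 1 only; meeting it with |h|, where the basic open
    set of [h] lies in [K], cuts its support down to [K] and keeps the value 1 at [m]. *)
Let below_point K m : open K -> K m -> exists2 g, below K g & rho m g = 1.
Proof.
move=> oK Km; have /maxSpec_nbhsP[h mh hK] := open_nbhs_nbhs (conj oK Km).
have [s ss nms] := specker_singular_notin spG (max_idealP m).1.
have minE m' : rho m' (s `&` labs h)%O = Num.min (rho m' s) `|rho m' h|.
  by rewrite (lhomZ_min (rho_lhom spG m')) (lhomZ_abs (rho_lhom spG m')).
have hm' m' : rho m' h = 0 \/ 1 <= `|rho m' h| /\ K m'.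
  have [|nm'h] := pselect (max_ideal m' h); first by move/(rho0P spG); left.
  right; split; last exact: hK.
  have : rho m' h <> 0 by move/(rho0P spG).
  lia.
exists (s `&` labs h)%O.
  move=> m'; rewrite minE.
  have [/(rho0P spG) -> | /(rho_singular spG ss) ->] := pselect (max_ideal m' s).
    by left; lia.
  by have [->|[h1 Km']] := hm' m'; [left|right; split=> //; lia].
rewrite minE (rho_singular spG ss nms).
have : rho m h <> 0 by move/(rho0P spG).
lia.
Qed.

Lemma natural_map_clopen K : clopen K ->
  exists g, forall m, natural_map g m = (m \in K)%:R.
Proof.
move=> [oK cK].
suff [g gK g1] : exists2 g, below K g & forall m, K m -> rho m g = 1.
  exists g => m; have [/set_mem/g1//|mK] := boolP (m \in K).
  by have [//|[_ Km]] := gK m; rewrite mem_set in mK.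
apply: contrapT => nog.
(* If no [g] in [below K] is 1 on all of [K], their zero sets in [K] have a cluster point, which is
   in [K] by closedness; [below_point] excludes it. *)
pose F := filter_from (below K) (fun g => K `&` [set m | rho m g = 0]).
have FF : ProperFilter F.
  apply: filter_from_proper; first apply: filter_from_filter.
  - by exists 0 => m; left; exact: (lhom0 (rho_lhom spG m)).
  - move=> g h gK hK; have [k kK kgh] := below_join gK hK.
    exists k => // m [Km /= k0]; split; split=> //=.
      by have [//|[g1 _]] := gK m; have := kgh m (or_introl g1); rewrite k0.
    by have [//|[h1 _]] := hK m; have := kgh m (or_intror h1); rewrite k0.
  - move=> g gK; apply: contrapT => nK; apply: nog; exists g => // m Km.
    by have [g0|[]//] := gK m; case: nK; exists m.
have [m [_ Fm]] := cG FF filterT.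
have FK g : below K g -> F (K `&` [set m | rho m g = 0]) by exists g.
have Km : K m.
  rewrite ((closure_id K).1 cK) => B Bm.
  have below0 : below K 0 by move=> m'; left; exact: (lhom0 (rho_lhom spG m')).
  by have [m' [[]]] := Fm _ _ (FK _ below0) Bm; exists m'.
have [g gK g1] := below_point oK Km.
have mg : nbhs m [set m' | ~ max_ideal m' g].
  by apply/maxSpec_nbhsP; exists g => // /(rho0P spG); rewrite g1.
have [m' [[_ /= g0] m'g]] := Fm _ _ (FK _ gK) mg.
by apply: m'g; exact/(rho0P spG).
Qed.

(** The continuous functions on the compact spectrum form a Specker group, so only singular ones,
    the indicators of clopen sets, need be hit. *)
Lemma natural_map_surj (f : contZ (maxSpec G)) :
  exists g, forall m, natural_map g m = f m.
Proof.
apply: (@specker_subgroup _ [set f : contZ (maxSpec G) |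
  exists g, forall m, natural_map g m = f m] (contZ_specker cG)) => {f}.
  split; first by exists 0 => m; exact: (lhom0 (rho_lhom spG m)).
  move=> f f' [g gf] [g' gf']; exists (g - g') => m.
  by rewrite /natural_map (lhomB (rho_lhom spG m)) [rho m g]gf [rho m g']gf'.
move=> s ss; have [g gE] := natural_map_clopen (contZ_clopen s [set 1]).
exists g => m; rewrite gE.
have [/set_mem /= ->//|mK] := boolP (m \in s @^-1` [set 1]).
by have [->//|s1] := contZ_singular01 ss m; rewrite mem_set in mK.
Qed.

End NaturalMapImage.

(** * Maximal ideals of the group of integer-valued functions *)

Section EvaluationIdeals.
Context {X : topologicalType}.
Implicit Types (f g : contZ X) (x y : X) (m : maxSpec (contZ X)).

Let ev x : contZ X -> int := fun f => f x.

Let ev_lhom x : is_lhom (ev x).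
Proof. by []. Qed.

Fact eval_ideal_maximal x : maximal_ideal [set f : contZ X | f x = 0].
Proof. by apply: (lhomZ_ker_maximal (ev_lhom x) (e := ContZ (@continuousZ_cst X 1))). Qed.

Definition eval_ideal x : maxSpec (contZ X) := MaxSpec (eval_ideal_maximal x).

Hypothesis bX : boolean_space X.

Let cX : compact [set: X].
Proof. by case: bX. Qed.

Lemma rho_eval_ideal x f : rho (eval_ideal x) f = f x.
Proof.
have spX := contZ_specker cX.
rewrite -(@rho_unique _ spX (eval_ideal x) (ev x)) //.
by rewrite -subTset => n _; exists (ContZ (@continuousZ_cst X n)).
Qed.

Lemma eval_ideal_cont : continuous eval_ideal.
Proof.
move=> x A /maxSpec_nbhsP[f fx fA].
apply: filterS ((continuousZP f).1 (contZ_cont f) x) => y /= fy.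
by apply: fA => /=; rewrite fy.
Qed.

Lemma eval_ideal_inj : injective eval_ideal.
Proof.
move=> x y /(congr1 (@max_ideal _)) xy; apply: contrapT => nxy.
have [_ _ hX] := bX.
have [K [cK Kx Ky]] : exists K, [/\ clopen K, K x & ~ K y].
  have : nbhs x (~` [set y]).
    apply: open_nbhs_nbhs; split=> //; apply: closed_openC.
    exact: accessible_closed_set1 (hausdorff_accessible hX) y.
  by move/(boolean_clopen_nbhs bX) => [K [cK Kx Ky]]; exists K; split=> // /Ky; exact.
have [f fE] := contZ_indicator cK.
have : [set f : contZ X | f x = 0] f by rewrite [X in X f]xy /= fE memNset.
by rewrite /= fE mem_set.
Qed.

Lemma eval_ideal_surj m : exists x, eval_ideal x = m.
Proof.
have [iM maxM] := max_idealP m.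
(* A common zero suffices: [m] is then contained in [eval_ideal x], and maximality gives
   equality. *)
suff [x mx] : exists x, forall f, max_ideal m f -> f x = 0.
  exists x; apply: maxSpec_eq; apply: maxM => //.
  exact: (eval_ideal_maximal x).1.
pose F := filter_from (max_ideal m) (fun f : contZ X => [set x | f x = 0]).
have absE f x : labs f x = `|f x| by rewrite -maxrN.
have FF : ProperFilter F.
  apply: filter_from_proper; first apply: filter_from_filter.
  - by exists 0; exact: ideal0.
  - move=> f g mf mg; exists (labs f + labs g).
      by apply: idealD => //; exact: ideal_abs.
    move=> x; change (labs f x + labs g x = 0 -> f x = 0 /\ g x = 0).
    by rewrite !absE; lia.
  (* If [f] has no zero, then |f| >= 1 and a multiple of |f| dominates any given bounded [g], so [m]
     would not be proper. *)
  - move=> f mf; apply: contrapT => f0.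
    have [_ _ _ /eqP] := iM; apply; rewrite -subTset => g _.
    apply: (ideal_absE iM); have [N gN] := contZ_bounded cX g.
    apply: (ideal_le iM (idealMn N iM (ideal_abs iM mf)) (lg_abs_ge0 g)).
    apply/contZ_leP => x; rewrite contZ_mulrnE !absE; apply: (le_trans (gN x)).
    have : f x <> 0 by move=> fx; apply: f0; exists x.
    by rewrite -mulr_natl; nia.
have [x [_ Fx]] := cX FF filterT.
exists x => f mf; have Ff : F [set y | f y = 0] by exists f.
by have [y [/= fy0 <-]] := Fx _ _ Ff ((continuousZP f).1 (contZ_cont f) x).
Qed.

(** Continuity of the inverse, phrased without an inverse map; the indicator of a clopen
    neighbourhood of [x] inside [A] defines the basic open set. *)
Lemma eval_ideal_open x (A : set X) : nbhs x A ->
  nbhs (eval_ideal x) [set m | forall y, eval_ideal y = m -> A y].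
Proof.
move/(boolean_clopen_nbhs bX) => [K [cK Kx KA]].
have [f fE] := contZ_indicator cK.
apply/maxSpec_nbhsP; exists f; first by rewrite /= fE mem_set.
move=> m /= mf y ym; apply: KA; apply: contrapT => nKy.
by apply: mf; rewrite -ym /= fE memNset.
Qed.

End EvaluationIdeals.

(** * The duality *)

Section DualMap.
Context {S T : uslg} (psi : uslg_hom S T).
Implicit Types (m : maxSpec T) (g : S).

Let rho_psi m : is_lhom (rho m \o psi).
Proof. exact: comp_is_lhom (rho_lhom (uslg_specker T) m) (uslg_lhom psi). Qed.

Let preimageE m : psi @^-1` max_ideal m = (rho m \o psi) @^-1` [set 0].
Proof. by rewrite -(rho_ker (uslg_specker T) m). Qed.

(** The preimage is the kernel of [rho m] after [psi], a map that is nonzero at the unit. *)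
Fact preimage_maximal m : maximal_ideal (psi @^-1` max_ideal m).
Proof.
rewrite preimageE; apply: (lhomZ_ker_maximal (rho_psi m) (e := uslg_unit S)).
by rewrite /= uslg_fun_unit gt_eqF ?rho_unit_gt0.
Qed.

Definition dual_map m : maxSpec S := MaxSpec (preimage_maximal m).

Lemma dual_map_cont : continuous dual_map.
Proof.
move=> m A /maxSpec_nbhsP[g mg gA]; apply/maxSpec_nbhsP.
by exists (psi g) => // m' m'g; apply: gA.
Qed.

Let rho_dual_factor m : exists d, forall g, rho m (psi g) = d * rho (dual_map m) g.
Proof.
have spS := uslg_specker S.
have [|d _ dE] := lhomZ_factor (rho_lhom spS (dual_map m)) (rho_psi m)
  (rho_range spS (dual_map m)).
  by move=> g /(rho0P spS) /= /(rho0P (uslg_specker T)).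
by exists d => g; exact: dE.
Qed.

Lemma dual_map_dvd m :
  (natural_map (uslg_unit S) (dual_map m) %| natural_map (uslg_unit T) m)%Z.
Proof.
have [d dE] := rho_dual_factor m.
by rewrite /natural_map -(uslg_fun_unit psi) dE dvdz_mull.
Qed.

(** Pointwise form of the naturality of the counit; the quotient is the factor [d], read off at the
    units. *)
Lemma rho_dual_map m g : rho m (psi g) = rho (dual_map m) g *
  (rho m (uslg_unit T) %/ rho (dual_map m) (uslg_unit S))%Z.
Proof.
have [d dE] := rho_dual_factor m.
rewrite -(uslg_fun_unit psi) !dE mulzK; first exact: mulrC.
by rewrite gt_eqF ?rho_unit_gt0.
Qed.

End DualMap.

Local Notation calB0 := (calB_obj maxSpec_multispace).

Definition dual_hom (S T : uslg) (psi : uslg_hom S T) :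
    bms_hom (calB0 T) (calB0 S) :=
  @BmsHom (calB0 T) (calB0 S) (dual_map psi) (@dual_map_cont _ _ psi)
    (@dual_map_dvd _ _ psi).

Definition calB_functor : @functor_on (op uSlg) Bms calB0.
Proof.
apply: (@FunctorOn (op uSlg) Bms calB0 (fun S T psi => dual_hom psi)).
- by move=> S; apply: bms_hom_eq => m; exact: maxSpec_eq.
- by move=> S T U f g; apply: bms_hom_eq => m; exact: maxSpec_eq.
Defined.

(** * The unit of the adjunction *)

Section Unit.
Variable X : bms.

Let bX : boolean_space X := bms_boolean X.

Fact eval_ideal_dvd (x : X) :
  (bms_unit (eval_ideal x : calB0 (calS_obj X)) %| bms_unit x)%Z.
Proof. by rewrite /= /natural_map rho_eval_ideal. Qed.

Definition unit_hom : bms_hom X (calB0 (calS_obj X)) :=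
  @BmsHom X (calB0 (calS_obj X)) eval_ideal (@eval_ideal_cont X) eval_ideal_dvd.

Lemma unit_hom_iso : is_iso (C := Bms) unit_hom.
Proof.
have [inv invK] := choice (eval_ideal_surj bX).
have inv_cont : continuous inv.
  move=> m A; rewrite -{2}(invK m) => /(eval_ideal_open bX).
  by apply: filterS => m' /(_ _ (invK m')).
have inv_dvd (m : calB0 (calS_obj X)) : (bms_unit (inv m) %| bms_unit m)%Z.
  by rewrite -[in bms_unit m](invK m) /= /natural_map rho_eval_ideal.
exists (@BmsHom (calB0 (calS_obj X)) X inv inv_cont inv_dvd).
split; apply: bms_hom_eq; last exact: invK.
by move=> x; apply: (eval_ideal_inj bX); exact: invK.
Qed.

End Unit.

(** * The counit of the adjunction *)

Section Counit.
Variable S : uslg.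

Let spS : specker S := uslg_specker S.
Let cS : compact [set: maxSpec S] := maxSpec_compact spS (uslg_is_unit S).

Definition counit_fun (g : S) : contZ (maxSpec S) :=
  ContZ (@natural_map_cont _ spS g).

Fact counit_lhom : is_lhom counit_fun.
Proof.
split=> f g; apply: contZ_eq => m.
- exact: (lhomB (rho_lhom spS m)).
- exact: (lhomZ_min (rho_lhom spS m)).
- exact: (lhomZ_max (rho_lhom spS m)).
Qed.

Fact counit_unit : counit_fun (uslg_unit S) = uslg_unit (calS_obj (calB0 S)).
Proof. exact: contZ_eq. Qed.

Definition counit_hom : uslg_hom S (calS_obj (calB0 S)) :=
  @UslgHom S (calS_obj (calB0 S)) counit_fun counit_lhom counit_unit.

Lemma counit_hom_bij : bijective counit_hom.
Proof.
have [inv invE] := choice (natural_map_surj spS cS).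
have invK : cancel inv counit_hom by move=> f; apply: contZ_eq => m; exact: invE.
exists inv => // g; apply/eqP; rewrite -subr_eq0; apply/eqP.
apply: (natural_map_inj spS) => m; rewrite (lhomB (rho_lhom spS m)).
apply/eqP; rewrite subr_eq0; apply/eqP.
exact: (congr1 (fun f : contZ (maxSpec S) => f m) (invK (counit_hom g))).
Qed.

End Counit.

Lemma uslg_bij_iso (S T : uslg) (f : uslg_hom S T) : bijective f ->
  is_iso (C := uSlg) f.
Proof.
move=> [g fK gK]; have fP := uslg_lhom f.
have gP : is_lhom g.
  by split=> x y; apply: (can_inj fK);
    rewrite ?(lhomB fP) ?(lhom_meet fP) ?(lhom_join fP) !gK.
have gu : g (uslg_unit T) = uslg_unit S by rewrite -(uslg_fun_unit f) fK.
by exists (UslgHom gP gu); split; apply: uslg_hom_eq => x /=; rewrite ?fK ?gK.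
Qed.

Theorem theorem5p6 :
  exists (wd : forall S : uslg, is_multispace (natural_map (uslg_unit S)))
         (calB : @functor_on (op uSlg) Bms (calB_obj wd)),
    (forall (S T : uslg) (psi : uslg_hom S T) (m : maxSpec T),
       max_ideal ((functor_map calB psi : bms_hom (calB_obj wd T) (calB_obj wd S)) m)
         = psi @^-1` max_ideal m)
    /\ exists (unitM : forall X : bms, bms_hom X (calB_obj wd (calS_obj X)))
              (counitN : forall S : uslg, uslg_hom S (calS_obj (calB_obj wd S))),
         [/\ forall (X : bms) (x : X),
               max_ideal (unitM X x) = [set f : contZ X | f x = 0],
             forall (S : uslg) (g : S) (m : maxSpec S),
               (counitN S g : contZ (maxSpec S)) m = natural_map g m
           & adjoint_equivalence (C := Bms) (D := op uSlg)
               calS calB unitM counitN].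
Proof.
exists maxSpec_multispace, calB_functor; split=> //.
exists unit_hom, counit_hom; split=> //; split.
(* Naturality of the unit: the quotient of the multispace units is nonzero, so multiplying by it
   does not change zeros. *)
- move=> X Y f; apply: bms_hom_eq => x; apply: maxSpec_eq.
  apply/seteqP; split=> g.
    change (g (f x) = 0 -> calS_fun f g x = 0).
    by rewrite calS_funE => ->; rewrite mul0r.
  change (calS_fun f g x = 0 -> g (f x) = 0); rewrite calS_funE => /eqP.
  rewrite mulf_eq0 => /orP[/eqP //|/eqP q0].
  have := divzK (bms_dvd f x); rewrite q0 mul0r => /eqP.
  by rewrite lt_eqF ?(bms_unitP X).2.
- move=> T S psi; apply: uslg_hom_eq => g; apply: contZ_eq => m.
  by rewrite [RHS]/= /natural_map rho_dual_map; exact: calS_funE.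
(* Left triangle: the unit preserves the multispace unit exactly, so the correcting quotient is
   1. *)
- move=> X; apply: uslg_hom_eq => f; apply: contZ_eq => x.
  apply: etrans (calS_funE (unit_hom X) _ x) _.
  rewrite /= /natural_map !(rho_eval_ideal (bms_boolean X)) /= divzz.
  by rewrite gt_eqF ?(bms_unitP X).2// mulr1.
(* Right triangle: [g] lies in the composite ideal exactly when [rho m g] is 0, that is, when [g]
   lies in [m]. *)
- move=> S; apply: bms_hom_eq => m; apply: maxSpec_eq.
  by apply/seteqP; split=> g /= /(rho0P (uslg_specker S)).
- exact: unit_hom_iso.
(* Passing to the opposite category only swaps the two inverse identities. *)
- move=> S; have [g [fg gf]] := uslg_bij_iso (@counit_hom_bij S).
  by exists g.
Qed.
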